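(* Consider the process on the unit sphere $\mathbb{S}^2\subset\mathbb{R}^3$ given by $$\mathrm{d}X = -\breve\Omega(t)\times X\,\mathrm{d}t-\gamma^2X\,\mathrm{d}t+\gamma X\times\mathrm{d}W,$$ and the von Mises--Fisher family $p_\theta(x)=\exp(\theta^{\mathsf T}x-\kappa(\|\theta\|))$, $\theta\in\mathbb{R}^3$, of densities on $\mathbb{S}^2$, where $\kappa(r)=-\log r+\log(4\pi)+\log\sinh r$. The projection filter based on the von Mises--Fisher family has the prediction equation $$\dot\theta_F = -\breve\Omega(t)\times\theta_F-\frac{\gamma^2\kappa'(\|\theta_F\|)}{\|\theta_F\|\,\kappa''(\|\theta_F\|)}\,\theta_F .$$
   Context: $\times$ is the vector cross product on $\mathbb{R}^3$, $\breve\Omega(t)\in\mathbb{R}^3$ is a given function of time, $\gamma$ is a real constant, $W$ is a standard Wiener process on $\mathbb{R}^3$, and $X(0)\in\mathbb{S}^2$ (then $X(t)\in\mathbb{S}^2$ for $t>0$). With $Q(x)=\gamma^2(\mathrm{I}\|x\|^2-xx^{\mathsf T})$, the generator of $X$ is $$\mathcal{G}[\phi]=-(\breve\Omega(t)\times x+\gamma^2x)^{\mathsf T}\nabla_x\phi+\frac12\operatorname{tr}[Q\nabla_x^2\phi].$$ The base measure $\lambda$ on $\mathbb{S}^2$ is the uniform (surface area, total mass $4\pi$) measure, and $\mathcal{G}^a$ is the (formal) adjoint of $\mathcal{G}$ in $\mathcal{L}_2(\mathbb{S}^2,\lambda)$. The formulas are read for $\theta\neq 0$. Projection filter prediction: for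 a parametric family $\{p_\theta\}$ of densities with Fisher information matrix $g(\theta)$, the tangent space at $\sqrt{p_\theta}$ is $\operatorname{span}\{\partial_{\theta_i}\sqrt{p_\theta}\}$, with $\langle\partial_{\theta_i}\sqrt{p_\theta},\partial_{\theta_j}\sqrt{p_\theta}\rangle=\frac14g_{i,j}(\theta)$, and the orthogonal projection of $\mathcal{L}_2(\mathbb{S}^2,\lambda)$ onto it is $\Pi_\theta v=4\sum_{i,j}g^{-1}_{i,j}(\theta)\langle v,\partial_{\theta_j}\sqrt{p_\theta}\rangle\,\partial_{\theta_i}\sqrt{p_\theta}$. The prediction equation of the projection filter is the evolution equation for the parameter curve $\theta_F(t)$ (between measurements) determined by $$\partial_t\sqrt{p_{\theta_F}}=\Pi_{\theta_F}\circ\mathcal{F}^{1/2}[\sqrt{p_{\theta_F}}],\qquad\mathcal{F}^{1/2}[\phi]=\frac{\phi}{2\phi^2}\mathcal{G}^a[\phi^2].$$ *)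

(* Defs.v *)
From HB Require Import structures.
From mathcomp Require Import all_boot all_order all_algebra.
From mathcomp Require Import ring.
From mathcomp Require Import all_classical all_reals all_analysis measurable_realfun.

Set Implicit Arguments.
Unset Strict Implicit.
Unset Printing Implicit Defensive.
Import Order.TTheory GRing.Theory Num.Theory.
Import numFieldNormedType.Exports.

Local Open Scope classical_set_scope.
Local Open Scope ring_scope.

Section euclidean_space.
Variable R : realType.

Definition dotv n (u v : 'cV[R]_n) : R := \sum_i u i 0 * v i 0.

(* The library's norm `|u| on matrices is the max norm, hence this one. *)
Definition enorm n (u : 'cV[R]_n) : R := Num.sqrt (dotv u u).

(* Indices are added in the ring 'I_3, that is, modulo 3. *)
Definition crossv (u v : 'cV[R]_3) : 'cV[R]_3 :=
  \col_i (u (i + 1) 0 * v (i + 2) 0 - u (i + 2) 0 * v (i + 1) 0).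

Definition cross_mx (x : 'cV[R]_3) : 'M[R]_3 :=
  \matrix_(i, j) crossv x (delta_mx j 0) i 0.

Lemma sum3E (F : 'I_3 -> R) : \sum_i F i = F 0 + F 1 + F 2.
Proof.
rewrite !big_ord_recl big_ord0 addr0 addrA.
by congr (F _ + F _ + F _); exact/val_inj.
Qed.

Lemma I3P (i : 'I_3) : [\/ i = 0, i = 1 | i = 2].
Proof.
by case: i => -[|[|[|//]]] hi; [constructor 1|constructor 2|constructor 3];
  exact/val_inj.
Qed.

Lemma I3D : ((0 + 1 = 1 :> 'I_3)%R * (0 + 2 = 2 :> 'I_3)%R *
  (1 + 1 = 2 :> 'I_3)%R * (1 + 2 = 0 :> 'I_3)%R *
  (2 + 1 = 0 :> 'I_3)%R * (2 + 2 = 1 :> 'I_3)%R)%type.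
Proof. by do !split; exact/val_inj. Qed.

Lemma cross_mxE (x w : 'cV[R]_3) : cross_mx x *m w = crossv x w.
Proof.
apply/matrixP => i j; rewrite ord1 mxE sum3E !mxE.
by case: (I3P i) => ->; rewrite !I3D /=; ring.
Qed.

Lemma cross_mx_tr (x : 'cV[R]_3) :
  cross_mx x *m (cross_mx x)^T = (enorm x ^+ 2)%:M - x *m x^T.
Proof.
have -> : enorm x ^+ 2 = dotv x x.
  by rewrite sqr_sqrtr// sumr_ge0// => i _; rewrite -expr2 sqr_ge0.
apply/matrixP => i j; rewrite !mxE sum3E big_ord1 !mxE /dotv sum3E.
by case: (I3P i) => ->; case: (I3P j) => ->; rewrite !I3D /=; ring.
Qed.

Definition partial n (i : 'I_n.+1) (f : 'cV[R]_n.+1 -> R) : 'cV[R]_n.+1 -> R :=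
  fun x => 'D_(delta_mx i 0) f x.

Definition gradient n (f : 'cV[R]_n.+1 -> R) (x : 'cV[R]_n.+1) : 'cV[R]_n.+1 :=
  \col_i partial i f x.

Definition hessian n (f : 'cV[R]_n.+1 -> R) (x : 'cV[R]_n.+1) : 'M[R]_n.+1 :=
  \matrix_(i, j) partial i (partial j f) x.

Fixpoint Cn n (k : nat) (f : 'cV[R]_n.+1 -> R) : Prop :=
  continuous f /\
  if k is k'.+1 then
    forall i : 'I_n.+1,
      (forall x, derivable f x (delta_mx i 0)) /\ Cn k' (partial i f)
  else True.

Definition smooth n (f : 'cV[R]_n.+1 -> R) : Prop := forall k, Cn k f.

End euclidean_space.

Section sphere_measure.
Variable R : realType.

Definition cylinders : set (set 'cV[R]_3) :=
  [set B | exists i : 'I_3, exists2 A : set R,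
     measurable A & B = [set x : 'cV[R]_3 | A (x i 0)]].

(* R^3 with its Borel sigma-algebra, generated by the coordinates. *)
Definition borelR3 := g_sigma_algebraType cylinders.
HB.instance Definition _ := Measurable.on borelR3.

Definition sphere : set borelR3 := [set x : 'cV[R]_3 | enorm x = 1].

(* Cylindrical coordinates (z, a) on the sphere. Since the partial derivatives
   of the chart with respect to z and a are orthogonal with norms
   1 / sqrt (1 - z^2) and sqrt (1 - z^2), the area element is dz da. *)
Definition sphere_chart (u : measurableTypeR R * measurableTypeR R) : borelR3 :=
  \col_(i < 3) [:: Num.sqrt (1 - u.1 ^+ 2) * cos u.2;
                   Num.sqrt (1 - u.1 ^+ 2) * sin u.2;
                   u.1]`_i.

Definition chart_domain : set (measurableTypeR R * measurableTypeR R) :=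
  `[-1, 1] `*` `[0, 2 * pi].

Lemma measurable_chart_domain : measurable chart_domain.
Proof. by apply: measurableX; exact: measurable_itv. Qed.

Lemma measurable_sphere_chart : measurable_fun setT sphere_chart.
Proof.
apply: (@measurability _ _ _ borelR3 _ _ cylinders) => //= _ [_ [i [A mA ->]] <-].
have mcomp (f : R -> R) : continuous f ->
    measurable_fun setT (fun u : measurableTypeR R * measurableTypeR R => f u.2).
  move=> cf; apply: measurableT_comp; last exact: measurable_snd.
  exact: continuous_measurable_fun.
have msqrt : measurable_fun setT
    (fun u : measurableTypeR R * measurableTypeR R => Num.sqrt (1 - u.1 ^+ 2)).
  apply: (measurableT_comp (f := fun z : R => Num.sqrt (1 - z ^+ 2)));
    last exact: measurable_fst.
  apply: continuous_measurable_fun => z.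
  apply: (@continuous_comp _ _ _ (fun z : R => 1 - z ^+ 2));
    last exact: sqrt_continuous.
  by apply: cvgB; [exact: cvg_cst|exact: exprn_continuous].
suff mi : measurable_fun setT (fun u => sphere_chart u i 0).
  by have := mi measurableT A mA; rewrite !setTI.
have -> : (fun u => sphere_chart u i 0) = (fun u =>
    [:: Num.sqrt (1 - u.1 ^+ 2) * cos u.2;
        Num.sqrt (1 - u.1 ^+ 2) * sin u.2; u.1]`_i).
  by apply/funext => u; rewrite mxE.
case: (I3P i) => -> /=.
- by apply: measurable_funM => //; apply: mcomp; exact: continuous_cos.
- by apply: measurable_funM => //; apply: mcomp; exact: continuous_sin.
- exact: measurable_fst.
Qed.

HB.instance Definition _ :=
  isMeasurableFun.Build _ _ _ _ sphere_chart measurable_sphere_chart.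

Definition sphere_measure : set borelR3 -> \bar R :=
  pushforward
    (mrestr (@lebesgue_measure R \x @lebesgue_measure R)%E
       measurable_chart_domain)
    sphere_chart.

Let sphere_measure0 : sphere_measure set0 = 0%E.
Proof. by rewrite /sphere_measure /pushforward preimage_set0 measure0. Qed.

Let sphere_measure_ge0 A : (0 <= sphere_measure A)%E.
Proof. exact: measure_ge0. Qed.

Let sphere_measure_sigma_additive : semi_sigma_additive sphere_measure.
Proof.
exact: (@measure_semi_sigma_additive _ _ _
  (measure_function_pushforward__canonical__measure_function_Measure _ measurable_sphere_chart)).
Qed.

HB.instance Definition _ := isMeasure.Build _ _ _ sphere_measure
  sphere_measure0 sphere_measure_ge0 sphere_measure_sigma_additive.

Lemma sphere_measure_sphere : sphere_measure sphere = (4 * pi)%:E.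
Proof.
rewrite /sphere_measure /pushforward /mrestr.
have -> : sphere_chart @^-1` sphere `&` chart_domain = chart_domain.
  apply/setIidPr => -[z a] [/= + _]; rewrite in_itv /= => /andP[z1 z2].
  have z0 : 0 <= 1 - z ^+ 2.
    by rewrite subr_ge0 -ler_sqrt// sqrtr1 sqrtr_sqr ler_norml z1.
  rewrite /sphere /= /enorm /dotv sum3E !mxE /= -!expr2 !exprMn sqr_sqrtr//.
  by rewrite -mulrDr cos2Dsin2 mulr1 subrK sqrtr1.
rewrite product_measure1E; [|exact: measurable_itv..].
have pi0 : 0 < 2 * pi :> R by rewrite mulr_gt0// pi_gt0.
rewrite /= !(lebesgue_measure_itv) /= !lte_fin pi0 gtrN // -!EFinB -EFinM.
by congr EFin; ring.
Qed.

End sphere_measure.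

Arguments sphere {R}.
Arguments sphere_measure : clear implicits.

Section L2_sphere.
Variable R : realType.

(* Only the values on the sphere of u, v : R^3 -> R matter. *)
Definition L2_sphere (u : 'cV[R]_3 -> R) : Prop :=
  measurable_fun sphere (u : borelR3 R -> R) /\
  (sphere_measure R).-integrable sphere
    (fun x : borelR3 R => (u x ^+ 2)%:E).

Definition integral_sphere (u : 'cV[R]_3 -> R) : R :=
  \int[sphere_measure R]_(x in sphere) u x.

Definition inner_sphere (u v : 'cV[R]_3 -> R) : R :=
  integral_sphere (fun x => u x * v x).

(* Smooth functions on R^3 stand for their restrictions to the sphere; every
   smooth function on the sphere is such a restriction. *)
Definition formal_adjoint (A Aa : ('cV[R]_3 -> R) -> 'cV[R]_3 -> R) : Prop :=
  forall psi, smooth psi ->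
    L2_sphere (Aa psi) /\
    forall phi, smooth phi ->
      inner_sphere (A phi) psi = inner_sphere phi (Aa psi).

End L2_sphere.

Section process.
Variable R : realType.

(* Generator of the Ito equation dX = b(X) dt + s(X) dW. *)
Definition ito_generator (b : 'cV[R]_3 -> 'cV[R]_3) (s : 'cV[R]_3 -> 'M[R]_3)
    (phi : 'cV[R]_3 -> R) (x : 'cV[R]_3) : R :=
  dotv (b x) (gradient phi x) +
  2^-1 * \tr (s x *m (s x)^T *m hessian phi x).

Variables (Omega : R -> 'cV[R]_3) (gamma : R).

(* dX = - Omega(t) \times X dt - gamma^2 X dt + gamma X \times dW *)
Definition drift (t : R) (x : 'cV[R]_3) : 'cV[R]_3 :=
  - crossv (Omega t) x - gamma ^+ 2 *: x.

Definition dispersion (x : 'cV[R]_3) : 'M[R]_3 := gamma *: cross_mx x.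

Definition generator (t : R) : ('cV[R]_3 -> R) -> 'cV[R]_3 -> R :=
  ito_generator (drift t) dispersion.

Definition diffusion (x : 'cV[R]_3) : 'M[R]_3 :=
  gamma ^+ 2 *: ((enorm x ^+ 2)%:M - x *m x^T).

Lemma generatorE t phi x : generator t phi x =
  - dotv (crossv (Omega t) x + gamma ^+ 2 *: x) (gradient phi x) +
  2^-1 * \tr (diffusion x *m hessian phi x).
Proof.
rewrite /generator /ito_generator; congr (_ + _).
  by rewrite /dotv -sumrN; apply: eq_bigr => i _; rewrite !mxE -opprD mulNr.
have -> // : dispersion x *m (dispersion x)^T = diffusion x.
by rewrite /dispersion linearZ -scalemxAl -scalemxAr scalerA -expr2 cross_mx_tr.
Qed.

End process.

Section projection_filter.
Variables (R : realType) (n : nat).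
Variable p : 'cV[R]_n.+1 -> 'cV[R]_3 -> R.
Implicit Type theta : 'cV[R]_n.+1.

Definition sqrt_density theta (x : 'cV[R]_3) : R := Num.sqrt (p theta x).

Definition tangent (i : 'I_n.+1) theta (x : 'cV[R]_3) : R :=
  partial i (fun th => sqrt_density th x) theta.

Definition fisher theta : 'M[R]_n.+1 :=
  \matrix_(i, j) integral_sphere (fun x =>
    partial i (fun th => ln (p th x)) theta *
    partial j (fun th => ln (p th x)) theta * p theta x).

(* invmx is the inverse only when the Fisher information is invertible, as it
   is for the von Mises-Fisher family at theta <> 0. *)
Definition tangent_projection theta (v : 'cV[R]_3 -> R) (x : 'cV[R]_3) : R :=
  4 * \sum_i \sum_j
    invmx (fisher theta) i j * inner_sphere v (tangent j theta) *
    tangent i theta x.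

Definition sqrt_forward (Ga : ('cV[R]_3 -> R) -> 'cV[R]_3 -> R)
    (phi : 'cV[R]_3 -> R) (x : 'cV[R]_3) : R :=
  phi x / (2 * phi x ^+ 2) * Ga (fun y => phi y ^+ 2) x.

Definition projection_filter_at
    (Ga : R -> ('cV[R]_3 -> R) -> 'cV[R]_3 -> R)
    (thetaF : R -> 'cV[R]_n.+1) (t : R) : Prop :=
  forall x, sphere x ->
    is_derive t 1 (fun s => sqrt_density (thetaF s) x)
      (tangent_projection (thetaF t)
        (sqrt_forward (Ga t) (sqrt_density (thetaF t))) x).

End projection_filter.

Section von_mises_fisher.
Variable R : realType.

Definition sinh (r : R) : R := (expR r - expR (- r)) / 2.

Definition kappa (r : R) : R := - ln r + ln (4 * pi) + ln (sinh r).

Definition vmf (theta x : 'cV[R]_3) : R :=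
  expR (dotv theta x - kappa (enorm theta)).

End von_mises_fisher.

(* Main.v *)
Require Import Defs.
From mathcomp Require Import all_boot all_order all_algebra.
From mathcomp Require Import ring lra.
From mathcomp Require Import all_classical all_reals all_analysis measurable_realfun.
Set Implicit Arguments.
Unset Strict Implicit.
Unset Printing Implicit Defensive.
Import Order.TTheory GRing.Theory Num.Theory numFieldNormedType.Exports.
Local Open Scope classical_set_scope.
Local Open Scope ring_scope.

(* Write Z, M and S for the integrals over the sphere of exp (theta . x) times
   1, x and x x^T, and ^ for the cross product. Rotation fields are
   divergence-free, hence (theta ^ v) . M = 0 and
   u . S (theta ^ v) = - (u ^ v) . M for all u and v;
   together with tr S = Z this determines M and S from Z and theta . M. Along
   the ray r |-> r theta these relations give (r Z)'' = |theta|^2 (r Z), and so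
   |theta| Z = 4 pi sinh |theta|. The mean of p_theta is then
   kappa' theta / |theta|, its covariance, which is the Fisher matrix, is
   kappa' / |theta| on the orthogonal of theta and kappa'' on theta, and both
   eigenvalues are positive.
   The log-densities have affine scores, so moving the adjoint onto the score
   turns the projection into g^-1 E[G x]. Conversely, the values of
   log p_theta at +e_i and -e_i differ by twice the i-th coordinate of theta,
   so the densities determine the derivative of theta. *)

(** * Bounded measurable functions on sets of finite measure *)

Section bounded_measurable.
Context d (T : measurableType d) (R : realType) (D : set T).
Implicit Types f g : T -> R.

(** A class closed under sums, products and [expR], which integrability alone is not; on a set of
    finite measure its members are integrable. *)
Definition bounded_measurable f :=
  measurable_fun D f /\ exists M, forall x, D x -> `|f x| <= M.

Lemma bounded_measurable_cst r : bounded_measurable (fun=> r).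
Proof. by split; [exact: measurable_cst|exists `|r|]. Qed.

Lemma bounded_measurableD f g :
  bounded_measurable f -> bounded_measurable g ->
  bounded_measurable (fun x => f x + g x).
Proof.
move=> [mf [M fM]] [mg [N gN]]; split; first exact: measurable_funD.
exists (M + N) => x Dx; rewrite (le_trans (ler_normD _ _))//.
by rewrite lerD ?fM ?gN.
Qed.

Lemma bounded_measurableN f :
  bounded_measurable f -> bounded_measurable (fun x => - f x).
Proof.
move=> [mf [M fM]]; split; first exact: measurableT_comp.
by exists M => x Dx; rewrite normrN fM.
Qed.

Lemma bounded_measurableM f g :
  bounded_measurable f -> bounded_measurable g ->
  bounded_measurable (fun x => f x * g x).
Proof.
move=> [mf [M fM]] [mg [N gN]]; split; first exact: measurable_funM.
by exists (M * N) => x Dx; rewrite normrM ler_pM ?fM ?gN.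
Qed.

Lemma bounded_measurable_expR f :
  bounded_measurable f -> bounded_measurable (fun x => expR (f x)).
Proof.
move=> [mf [M fM]]; split; first exact: (measurableT_comp (@measurable_expR R)).
exists (expR M) => x Dx; rewrite ger0_norm ?expR_ge0// ler_expR.
exact: le_trans (ler_norm _) (fM _ Dx).
Qed.

Lemma bounded_measurable_integrable (mu : {measure set T -> \bar R}) f :
  measurable D -> (mu D < +oo)%E -> bounded_measurable f ->
  mu.-integrable D (EFin \o f).
Proof.
move=> mD muD [mf [M fM]]; apply: measurable_bounded_integrable => //.
exists M; split; first exact: num_real.
by move=> N MN x Dx; exact: le_trans (fM _ Dx) (ltW MN).
Qed.

End bounded_measurable.

Lemma bounded_measurableW d (T : measurableType d) (R : realType) (D E : set T)
  (f : T -> R) : measurable E -> D `<=` E ->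
  bounded_measurable E f -> bounded_measurable D f.
Proof.
move=> mE DE [mf [M fM]]; split; first exact: measurable_funS mf.
by exists M => x /DE/fM.
Qed.

(** * Fubini's theorem for real-valued integrals over rectangles *)

Section rectangle.
Context {R : realType}.
Notation mu := (@lebesgue_measure R).
Notation R2 := (measurableTypeR R * measurableTypeR R)%type.
Variables (A B : set (measurableTypeR R)).
Hypotheses (mA : measurable A) (mB : measurable B).
Hypotheses (Aoo : (mu A < +oo)%E) (Boo : (mu B < +oo)%E).

Let rectangle_ltoo : ((mu \x mu) (A `*` B) < +oo)%E.
Proof. by rewrite product_measure1E//= lte_mul_pinfty// ge0_fin_numE. Qed.

Lemma bounded_measurable_section (h : R2 -> R) x :
  bounded_measurable setT h -> bounded_measurable setT (fun y => h (x, y)).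
Proof.
move=> [mh [M hM]]; split; last by exists M => y _; exact: hM.
by apply: (measurableT_comp mh); exact: measurable_pair1.
Qed.

Lemma bounded_measurable_section2 (h : R2 -> R) y :
  bounded_measurable setT h -> bounded_measurable setT (fun x => h (x, y)).
Proof.
move=> [mh [M hM]]; split; last by exists M => x _; exact: hM.
by apply: (measurableT_comp mh); exact: measurable_pair2.
Qed.

Variable h : R2 -> R.
Hypothesis bh : bounded_measurable setT h.

(** Extension by zero, which reduces the rectangle to Fubini's theorem on the whole plane. *)
Let g := (EFin \o h) \_ (A `*` B).

Let mAB : measurable (A `*` B). Proof. exact: measurableX. Qed.

Let intg : (mu \x mu)%E.-integrable setT g.
Proof.
apply/integrable_restrict => //; rewrite setTI.
apply: bounded_measurable_integrable => //.
exact: bounded_measurableW bh.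
Qed.

(** Fubini's theorem concerns extended reals; since [h] is bounded and the sides have finite
    measure, each inner integral is finite and survives [fine]. *)
Lemma Rintegral_rectangle12 :
  \int[(mu \x mu)%E]_(u in A `*` B) h u =
  \int[mu]_(x in A) \int[mu]_(y in B) h (x, y).
Proof.
congr fine; rewrite integral_mkcond -/g -integral12_prod_meas1//.
rewrite [RHS]integral_mkcond; apply: eq_integral => x _.
rewrite patchE; case: ifPn => [xA|xA]; last first.
  rewrite /fubini_F; apply: integral0_eq => y _; rewrite /g patchE ifN//.
  by apply/negP => /set_mem[/= /mem_set]; rewrite (negbTE xA).
rewrite [LHS](_ : _ = \int[mu]_(y in B) (h (x, y))%:E)%E; last first.
  rewrite [RHS]integral_mkcond; apply: eq_integral => y _.
  rewrite /g !patchE in_setX xA/=.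
  by case: ifPn.
rewrite fineK//; apply: integrable_fin_num => //.
apply: bounded_measurable_integrable => //.
exact: bounded_measurableW (bounded_measurable_section x bh).
Qed.

Lemma Rintegral_rectangle21 :
  \int[(mu \x mu)%E]_(u in A `*` B) h u =
  \int[mu]_(y in B) \int[mu]_(x in A) h (x, y).
Proof.
congr fine; rewrite integral_mkcond -/g -integral21_prod_meas1//.
rewrite [RHS]integral_mkcond; apply: eq_integral => y _.
rewrite patchE; case: ifPn => [yB|yB]; last first.
  rewrite /fubini_G; apply: integral0_eq => x _; rewrite /g patchE ifN//.
  by apply/negP => /set_mem[/= _ /mem_set]; rewrite (negbTE yB).
rewrite [LHS](_ : _ = \int[mu]_(x in A) (h (x, y))%:E)%E; last first.
  rewrite [RHS]integral_mkcond; apply: eq_integral => x _.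
  rewrite /g !patchE in_setX yB/= andbT.
  by case: ifPn.
rewrite fineK//; apply: integrable_fin_num => //.
apply: bounded_measurable_integrable => //.
exact: bounded_measurableW (bounded_measurable_section2 y bh).
Qed.

End rectangle.

Lemma lebesgue_measure_segment_ltoo (R : realType) (a b : R) :
  (@lebesgue_measure R `[a, b] < +oo)%E.
Proof.
by rewrite lebesgue_measure_itv/=; case: ifPn => _; rewrite -?EFinB ltry.
Qed.

(** * The fundamental theorem of calculus and the substitution z = cos p *)

Section one_variable.
Context {R : realType}.
Notation mu := (@lebesgue_measure R).
Implicit Types f g : R -> R.

Lemma is_derive_continuous f (df : R -> R) :
  (forall x : R, is_derive x (1 : R) f (df x)) -> continuous f.
Proof.
by move=> Df x; apply/differentiable_continuous/derivable1_diffP; case: (Df x).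
Qed.

Lemma Rintegral_is_derive (F f : R -> R) a b : a < b ->
  (forall x : R, is_derive x (1 : R) F (f x)) -> continuous f ->
  \int[mu]_(x in `[a, b]) f x = F b - F a.
Proof.
move=> ab DF cf; rewrite /Rintegral (@continuous_FTC2 _ f F)//.
- exact: continuous_subspaceT.
- split=> [x _||]; first by case: (DF x).
  + by apply: cvg_at_right_filter; exact: is_derive_continuous DF a.
  + by apply: cvg_at_left_filter; exact: is_derive_continuous DF b.
- by move=> x _; rewrite derive1E; case: (DF x).
Qed.

(** Passing from the height [z] to the polar angle removes the factor sqrt (1 - z^2) of the chart,
    which is not differentiable at the poles. The minus sign in the derivative of [cos] is absorbed
    because [cos] decreases from 1 to -1. *)
Lemma Rintegral_cos_subst f : continuous f ->
  \int[mu]_(z in `[-1, 1]) f z = \int[mu]_(p in `[0, pi]) (f (cos p) * sin p).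
Proof.
move=> cf; have Dcos : derive1 (@cos R) = (fun x => - sin x).
  by apply/funext => x; rewrite derive1E derive_val.
have csin : continuous (fun x : R => - sin x).
  by move=> x; apply: cvgN; exact: continuous_sin.
congr fine; rewrite -[in LHS](@cospi R) -[X in `[_, X]](@cos0 R).
rewrite (@integration_by_substitution_decreasing _ cos f 0 pi) ?pi_ge0//.
- by apply: eq_integral => x _; rewrite Dcos/= opprK.
- by move=> x y x0pi y0pi; rewrite ltr_cos.
- by rewrite Dcos => x _; exact: csin.
- by rewrite Dcos; apply/cvg_ex; eexists; apply: cvg_at_right_filter; exact: csin.
- by rewrite Dcos; apply/cvg_ex; eexists; apply: cvg_at_left_filter; exact: csin.
- split=> [x _||]; first exact: derivable_cos.
  + by apply: cvg_at_right_filter; exact: continuous_cos.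
  + by apply: cvg_at_left_filter; exact: continuous_cos.
- exact: continuous_subspaceT.
Qed.

End one_variable.

(** * Integration over the sphere in polar coordinates *)

Section sphere_integral.
Context {R : realType}.
Notation mu := (@lebesgue_measure R).
Implicit Types (x : 'cV[R]_3) (f g : 'cV[R]_3 -> R).

Lemma dotv3 (u v : 'cV[R]_3) :
  dotv u v = u 0 0 * v 0 0 + u 1 0 * v 1 0 + u 2 0 * v 2 0.
Proof. by rewrite /dotv sum3E. Qed.

Lemma dotvv_ge0 n (u : 'cV[R]_n) : 0 <= dotv u u.
Proof. by rewrite sumr_ge0// => i _; rewrite -expr2 sqr_ge0. Qed.

Lemma sphereP x : sphere x <-> dotv x x = 1.
Proof.
rewrite /sphere /= /enorm; split=> [x1|->]; last by rewrite sqrtr1.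
by rewrite -(sqr_sqrtr (dotvv_ge0 x)) x1 expr1n.
Qed.

Lemma measurable_coord i : measurable_fun setT (fun x : borelR3 R => x i 0).
Proof.
move=> _ A mA; rewrite setTI; apply: sub_gen_smallest.
by exists i; exists A.
Qed.

Lemma measurable_sphere : measurable (@sphere R).
Proof.
have -> : @sphere R = (fun x : borelR3 R => dotv x x) @^-1` [set 1].
  by apply/seteqP; split=> x /=; rewrite sphereP.
rewrite -[X in measurable X]setTI.
suff : measurable_fun setT (fun x : borelR3 R => dotv x x) by exact.
under eq_fun do rewrite dotv3.
by repeat apply: measurable_funD; apply: measurable_funM => //;
  exact: measurable_coord.
Qed.

Lemma sphere_measure_ltoo : (sphere_measure R (@sphere R) < +oo)%E.
Proof. by rewrite sphere_measure_sphere ltry. Qed.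

Lemma sphere_chart_sphere (z a : R) :
  -1 <= z <= 1 -> sphere (sphere_chart (z, a)).
Proof.
move=> z1; apply/sphereP.
have z0 : 0 <= 1 - z ^+ 2.
  by rewrite subr_ge0 -ler_sqrt// sqrtr1 sqrtr_sqr ler_norml.
rewrite dotv3 !mxE /= -!expr2 !exprMn sqr_sqrtr//.
by rewrite -mulrDr cos2Dsin2 mulr1 subrK.
Qed.

(** Measurability and boundedness on the sphere give integrability; continuity in the height [z] at
    each fixed angle [a] is what the substitution z = cos p asks for. *)
Definition sphere_regular f :=
  [/\ measurable_fun setT (f : borelR3 R -> R),
      exists M, forall x, sphere x -> `|f x| <= M &
      forall a, continuous (fun z => f (sphere_chart (z, a)))].

Lemma sphere_regular_cst r : sphere_regular (fun=> r).
Proof.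
split; [exact: measurable_cst|by exists `|r| |].
by move=> a; exact: cst_continuous.
Qed.

Lemma sphere_regularD f g : sphere_regular f -> sphere_regular g ->
  sphere_regular (fun x => f x + g x).
Proof.
move=> [mf [M fM] cf] [mg [N gN] cg]; split; first exact: measurable_funD.
- exists (M + N) => x Sx; rewrite (le_trans (ler_normD _ _))//.
  by rewrite lerD ?fM ?gN.
- by move=> a z; apply: cvgD; [exact: cf|exact: cg].
Qed.

Lemma sphere_regularM f g : sphere_regular f -> sphere_regular g ->
  sphere_regular (fun x => f x * g x).
Proof.
move=> [mf [M fM] cf] [mg [N gN] cg]; split; first exact: measurable_funM.
- by exists (M * N) => x Sx; rewrite normrM ler_pM ?fM ?gN.
- by move=> a z; apply: cvgM; [exact: cf|exact: cg].
Qed.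

Lemma sphere_regular_expR f : sphere_regular f ->
  sphere_regular (fun x => expR (f x)).
Proof.
move=> [mf [M fM] cf]; split.
- exact: (measurableT_comp (@measurable_expR R)).
- exists (expR M) => x Sx; rewrite ger0_norm ?expR_ge0// ler_expR.
  exact: le_trans (ler_norm _) (fM _ Sx).
- move=> a z; apply: (@continuous_comp _ _ _ _ expR); first exact: cf.
  exact: continuous_expR.
Qed.

Lemma sphere_regular_coord i : sphere_regular (fun x => x i 0).
Proof.
split; first exact: measurable_coord.
- exists 1 => x /sphereP x1; rewrite -(@ler_pXn2r _ 2)//= ?nnegrE// expr1n.
  rewrite real_normK ?num_real// -x1 dotv3 -!expr2.
  have x0 j : 0 <= x j 0 ^+ 2 by exact: sqr_ge0.
  by case: (I3P i) => ->; have := x0 0; have := x0 1; have := x0 2; lra.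
- have csqrt : continuous (fun z : R => Num.sqrt (1 - z ^+ 2)).
    move=> z; apply: (@continuous_comp _ _ _ (fun z : R => 1 - z ^+ 2));
      last exact: sqrt_continuous.
    by apply: cvgB; [exact: cvg_cst|exact: exprn_continuous].
  move=> a; rewrite (_ : (fun z => _) = (fun z => [:: Num.sqrt (1 - z ^+ 2) * cos a;
      Num.sqrt (1 - z ^+ 2) * sin a; z]`_i)); last first.
    by apply/funext => z; rewrite mxE.
  case: (I3P i) => -> /=.
  + by move=> z; apply: cvgM; [exact: csqrt|exact: cvg_cst].
  + by move=> z; apply: cvgM; [exact: csqrt|exact: cvg_cst].
  + by move=> z; exact: cvg_id.
Qed.

Lemma sphere_regular_dotv u : sphere_regular (dotv u).
Proof.
have -> : dotv u = (fun x => u 0 0 * x 0 0 + u 1 0 * x 1 0 + u 2 0 * x 2 0).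
  by apply/funext => x; rewrite dotv3.
have uM i : sphere_regular (fun x => u i 0 * x i 0).
  by apply: sphere_regularM;
    [exact: sphere_regular_cst|exact: sphere_regular_coord].
by apply: sphere_regularD => //; exact: sphere_regularD.
Qed.

Lemma sphere_regular_integrable f : sphere_regular f ->
  (sphere_measure R).-integrable sphere (EFin \o (f : borelR3 R -> R)).
Proof.
move=> [mf [M fM] _]; apply: bounded_measurable_integrable.
- exact: measurable_sphere.
- exact: sphere_measure_ltoo.
- by split; [exact: measurable_funTS|exists M].
Qed.

Definition polar (p a : R) : 'cV[R]_3 :=
  \col_(i < 3) [:: sin p * cos a; sin p * sin a; cos p]`_i.

Lemma integral_sphere_chart f : sphere_regular f ->
  integral_sphere f =
  \int[(mu \x mu)%E]_(u in @chart_domain R) f (sphere_chart u).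
Proof.
move=> rf; have [mf [M fM] _] := rf.
have mS := @measurable_sphere_chart R.
have domS : @chart_domain R `<=` @sphere_chart R @^-1` sphere.
  by move=> [z a] [/= + _]; rewrite in_itv/=; exact: sphere_chart_sphere.
have mE : measurable (@sphere_chart R @^-1` sphere).
  by have := mS measurableT _ measurable_sphere; rewrite setTI.
have mD := @measurable_chart_domain R.
pose nu := mrestr (mu \x mu)%E mD.
have nuE : (nu (@sphere_chart R @^-1` sphere) < +oo)%E.
  have := sphere_measure_ltoo; exact.
have bfS : bounded_measurable (@sphere_chart R @^-1` sphere) (f \o @sphere_chart R).
  split; last by exists M => u; exact: fM.
  by apply: measurable_funTS; exact: measurableT_comp.
have intf : nu.-integrable (@sphere_chart R @^-1` sphere)
    ((EFin \o f) \o @sphere_chart R).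
  exact: bounded_measurable_integrable.
congr fine.
pose m2 := measure_function_pushforward__canonical__measure_function_Measure nu mS.
transitivity (\int[m2]_(x in sphere) (EFin \o f) x)%E.
  exact: eq_measure_integral.
transitivity (\int[nu]_(u in @sphere_chart R @^-1` sphere)
    ((EFin \o f) \o @sphere_chart R) u)%E.
  apply: integral_pushforward => //; last exact: measurable_sphere.
  exact/measurable_EFinP.
(* The restricted measure [nu] gives no mass to the complement of the chart domain, so the preimage
   of the sphere can be cut down to that domain. *)
transitivity (\int[nu]_(u in (@sphere_chart R @^-1` sphere) `\` ~` (@chart_domain R))
    ((EFin \o f) \o @sphere_chart R) u)%E.
  apply: negligible_integral => //; first exact: measurableC.
  transitivity ((mu \x mu)%E (~` @chart_domain R `&` @chart_domain R)) => //.
  by rewrite setICl measure0.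
have -> : (@sphere_chart R @^-1` sphere) `\` ~` (@chart_domain R) = @chart_domain R.
  by rewrite setDE setCK; exact/setIidr.
apply: eq_measure_integral => A mA AD.
by rewrite /nu/= /mrestr (setIidl AD).
Qed.

Lemma sphere_chart_cos (p a : R) : p \in `[0, pi] ->
  sphere_chart (cos p, a) = polar p a.
Proof.
move=> p0; apply/matrixP => i j; rewrite !mxE /=.
have -> : Num.sqrt (1 - cos p ^+ 2) = sin p.
  rewrite -(cos2Dsin2 p) addrAC subrr add0r sqrtr_sqr ger0_norm//.
  exact: sin_ge0_pi.
by case: (I3P i) => ->.
Qed.

Lemma integral_sphere_polar f : sphere_regular f ->
  integral_sphere f =
  \int[mu]_(a in `[0, 2 * pi]) \int[mu]_(p in `[0, pi]) (f (polar p a) * sin p).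
Proof.
move=> rf; have [mf [M fM] cf] := rf.
rewrite integral_sphere_chart//.
(* The rectangle lemmas ask for a bound on the whole plane, but for |z| > 1 the chart leaves the
   sphere, where [f] has no known bound; hence the extension by zero. *)
pose h : measurableTypeR R * measurableTypeR R -> R :=
  (fun u => f (sphere_chart u)) \_ (@chart_domain R).
have bh : bounded_measurable setT h.
  split.
    have mfc : measurable_fun (@chart_domain R) (f \o @sphere_chart R).
      apply: measurable_funTS.
      exact: measurableT_comp mf (@measurable_sphere_chart R).
    exact: ((measurable_restrictT _ (@measurable_chart_domain R)).1 mfc).
  exists `|M| => -[z a] _; rewrite /h patchE; case: ifPn => [|_]; last by rewrite normr0.
  move=> /set_mem[/= + _]; rewrite in_itv/= => /(sphere_chart_sphere a)/fM.
  by move=> /le_trans; apply; exact: ler_norm.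
transitivity (\int[(mu \x mu)%E]_(u in @chart_domain R) h u).
  by apply: eq_Rintegral => u uD; rewrite /h patchE uD.
rewrite /chart_domain Rintegral_rectangle21//;
  do ?exact: lebesgue_measure_segment_ltoo.
apply: eq_Rintegral => a /set_mem/= aD.
transitivity (\int[mu]_(z in `[-1, 1]) f (sphere_chart (z, a))).
  apply: eq_Rintegral => z /set_mem/= zD.
  by rewrite /h patchE mem_set.
rewrite (Rintegral_cos_subst (cf a)); apply: eq_Rintegral => p /set_mem/= pD.
by rewrite sphere_chart_cos.
Qed.

End sphere_integral.

(** * Linearity of the sphere integral *)

Section sphere_linearity.
Context {R : realType}.
Implicit Types f g : 'cV[R]_3 -> R.

Lemma integral_sphereD f g : sphere_regular f -> sphere_regular g ->
  integral_sphere (fun x => f x + g x) = integral_sphere f + integral_sphere g.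
Proof.
move=> rf rg; apply: RintegralD; first exact: measurable_sphere.
- exact: sphere_regular_integrable.
- exact: sphere_regular_integrable.
Qed.

Lemma integral_sphereZ r f : sphere_regular f ->
  integral_sphere (fun x => r * f x) = r * integral_sphere f.
Proof.
move=> rf; apply: RintegralZl; first exact: measurable_sphere.
exact: sphere_regular_integrable.
Qed.

Lemma eq_integral_sphere f g : (forall x, sphere x -> f x = g x) ->
  integral_sphere f = integral_sphere g.
Proof. by move=> fg; apply: eq_Rintegral => x /set_mem; exact: fg. Qed.

End sphere_linearity.

(** * Integration by parts along rotation fields *)

Section rotation.
Context {R : realType}.
Notation mu := (@lebesgue_measure R).
Notation R2 := (measurableTypeR R * measurableTypeR R)%type.
Implicit Types theta u v : 'cV[R]_3.

Let bm_fst (f : R -> R) : continuous f -> (forall x, `|f x| <= 1) ->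
  bounded_measurable setT (fun q : R2 => f q.1).
Proof.
move=> cf f1; split; last by exists 1.
apply: measurableT_comp; last exact: measurable_fst.
exact: continuous_measurable_fun.
Qed.

Let bm_snd (f : R -> R) : continuous f -> (forall x, `|f x| <= 1) ->
  bounded_measurable setT (fun q : R2 => f q.2).
Proof.
move=> cf f1; split; last by exists 1.
apply: measurableT_comp; last exact: measurable_snd.
exact: continuous_measurable_fun.
Qed.

Let cos1 (x : R) : `|cos x| <= 1. Proof. by rewrite ler_norml cos_geN1 cos_le1. Qed.
Let sin1 (x : R) : `|sin x| <= 1. Proof. by rewrite ler_norml sin_geN1 sin_le1. Qed.

(** With the derivative existentially quantified, instance resolution can fill it in, and the second
    derivatives below need not be written out. *)
Let continuous_ex_derive (f : R -> R) :
  (forall x : R, exists a, is_derive x (1 : R) f a) -> continuous f.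
Proof. by move=> /choice[df]; exact: is_derive_continuous. Qed.

Ltac bm_rules := repeat first
  [ exact: bounded_measurable_cst
  | exact: (bm_fst (@continuous_cos R) cos1)
  | exact: (bm_fst (@continuous_sin R) sin1)
  | exact: (bm_snd (@continuous_cos R) cos1)
  | exact: (bm_snd (@continuous_sin R) sin1)
  | apply: bounded_measurableD | apply: bounded_measurableN
  | apply: bounded_measurableM | apply: bounded_measurable_expR ].

Section fixed.
Variables (theta u v : 'cV[R]_3) (c : R).

(** [lin w] is the inner product of [w] with the point of polar coordinates (p, a); [lin_p] and
    [lin_a] are its partial derivatives. *)
Let lin (w : 'cV[R]_3) (p a : R) : R :=
  w 0 0 * (sin p * cos a) + w 1 0 * (sin p * sin a) + w 2 0 * cos p.
Let lin_p (w : 'cV[R]_3) (p a : R) : R :=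
  w 0 0 * (cos p * cos a) + w 1 0 * (cos p * sin a) + - (w 2 0 * sin p).
Let lin_a (w : 'cV[R]_3) (p a : R) : R :=
  - (w 0 0 * (sin p * sin a)) + w 1 0 * (sin p * cos a).

(** The field x |-> v ^ x in the coordinates (p, a), times the area density [sin p] and the function
    (c + u . x) exp (theta . x). Its speed in [a] carries a factor 1 / sin p, which the density
    cancels in [F2]. *)
Let F1 (p a : R) : R := sin p * (- (v 0 0 * sin a) + v 1 0 * cos a) *
  ((c + lin u p a) * expR (lin theta p a)).
Let F2 (p a : R) : R := - lin_p v p a *
  ((c + lin u p a) * expR (lin theta p a)).
Let D1 (p a : R) : R :=
  cos p * (- (v 0 0 * sin a) + v 1 0 * cos a) *
  ((c + lin u p a) * expR (lin theta p a)) +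
  sin p * (- (v 0 0 * sin a) + v 1 0 * cos a) *
  ((lin_p u p a + (c + lin u p a) * lin_p theta p a) * expR (lin theta p a)).
Let D2 (p a : R) : R :=
  (v 0 0 * (cos p * sin a) + - (v 1 0 * (cos p * cos a))) *
  ((c + lin u p a) * expR (lin theta p a)) +
  - lin_p v p a *
  ((lin_a u p a + (c + lin u p a) * lin_a theta p a) * expR (lin theta p a)).

Let is_derive_F1 (a p : R) : is_derive p (1 : R) (F1 ^~ a) (D1 p a).
Proof.
rewrite /F1 /D1 /lin_p /lin; apply: is_derive_eq.
by rewrite /GRing.scale/=; ring.
Qed.

Let is_derive_F2 (p a : R) : is_derive a (1 : R) (F2 p) (D2 p a).
Proof.
rewrite /F2 /D2 /lin_p /lin_a /lin; apply: is_derive_eq.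
by rewrite /GRing.scale/=; ring.
Qed.

Let continuous_D1 (a : R) : continuous (D1 ^~ a).
Proof.
apply: continuous_ex_derive => p; rewrite /D1 /lin_p /lin; eexists.
exact: is_derive_eq.
Qed.

Let continuous_D2 (p : R) : continuous (D2 p).
Proof.
apply: continuous_ex_derive => a; rewrite /D2 /lin_p /lin_a /lin; eexists.
exact: is_derive_eq.
Qed.

Let bounded_measurable_D1 : bounded_measurable setT (fun q : R2 => D1 q.1 q.2).
Proof. by rewrite /D1 /lin_p /lin; bm_rules. Qed.

Let bounded_measurable_D2 : bounded_measurable setT (fun q : R2 => D2 q.1 q.2).
Proof. by rewrite /D2 /lin_p /lin_a /lin; bm_rules. Qed.

(* The rotation field x |-> v ^ x is divergence-free: in polar coordinates its
   action on a function, times the area density sin p, is the divergence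
   D1 + D2 of a vector field (F1, F2) with F1 = 0 at the poles and F2 periodic. *)
Lemma integral_sphere_rotation :
  integral_sphere (fun x => (dotv (crossv u v) x +
    (c + dotv u x) * dotv (crossv theta v) x) * expR (dotv theta x)) = 0.
Proof.
rewrite integral_sphere_polar; last first.
  apply: sphere_regularM; last exact/sphere_regular_expR/sphere_regular_dotv.
  apply: sphere_regularD; first exact: sphere_regular_dotv.
  apply: sphere_regularM; last exact: sphere_regular_dotv.
  apply: sphere_regularD; first exact: sphere_regular_cst.
  exact: sphere_regular_dotv.
pose D : R2 -> R := fun q => D1 q.1 q.2 + D2 q.1 q.2.
transitivity (\int[mu]_(a in `[0, 2 * pi]) \int[mu]_(p in `[0, pi]) D (p, a)).
  apply: eq_Rintegral => a _; apply: eq_Rintegral => p _.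
  have linE w : dotv w (polar p a) = lin w p a by rewrite dotv3 !mxE.
  rewrite /D/= /D1 /D2 !linE.
  move: (c + _) (expR _) => H E.
  rewrite /lin /lin_p /lin_a !mxE !I3D.
  (* The two sides agree only up to a multiple of cos^2 a + sin^2 a - 1, which is exhibited
     explicitly. *)
  apply: subr0_eq.
  transitivity (- sin p * ((u 0 0 * v 1 0 - u 1 0 * v 0 0) * cos p +
    H * ((theta 0 0 * v 1 0 - theta 1 0 * v 0 0) * cos p)) * E *
    (cos a ^+ 2 + sin a ^+ 2 - 1)).
    by ring.
  by rewrite cos2Dsin2 subrr mulr0.
pose A : set (measurableTypeR R) := `[0, pi]%classic.
pose B : set (measurableTypeR R) := `[0, 2 * pi]%classic.
have mA : measurable A by exact: measurable_itv.
have mB : measurable B by exact: measurable_itv.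
have Aoo : (mu A < +oo)%E by exact: lebesgue_measure_segment_ltoo.
have Boo : (mu B < +oo)%E by exact: lebesgue_measure_segment_ltoo.
rewrite -(@Rintegral_rectangle21 R A B mA mB Aoo Boo D); last first.
  exact: bounded_measurableD.
have mX : measurable (A `*` B) by apply: measurableX.
have fX : ((mu \x mu)%E (A `*` B) < +oo)%E.
  by rewrite product_measure1E//; apply: lte_mul_pinfty; rewrite ?ge0_fin_numE.
rewrite RintegralD//; last 2 first.
- by apply: bounded_measurable_integrable => //; exact: bounded_measurableW bounded_measurable_D1.
- by apply: bounded_measurable_integrable => //; exact: bounded_measurableW bounded_measurable_D2.
(* The two halves are integrated in opposite orders, each first in the variable in which it is a
   derivative. *)
rewrite (@Rintegral_rectangle21 R A B mA mB Aoo Boo _ bounded_measurable_D1)//.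
rewrite (@Rintegral_rectangle12 R A B mA mB Aoo Boo _ bounded_measurable_D2)//.
rewrite [X in X + _](_ : _ = 0) ?add0r; last first.
  transitivity (\int[mu]_(a in B) (0 : R)); last first.
    by rewrite Rintegral_cst ?mul0r.
  apply: eq_Rintegral => a _.
  rewrite (Rintegral_is_derive (pi_gt0 R) (is_derive_F1 a))//.
  by rewrite /F1 sinpi sin0 !mul0r subrr.
transitivity (\int[mu]_(p in A) (0 : R)); last first.
  by rewrite Rintegral_cst ?mul0r.
apply: eq_Rintegral => p _.
have pi2 : 0 < 2 * pi :> R by rewrite mulr_gt0// pi_gt0.
rewrite (Rintegral_is_derive pi2 (is_derive_F2 p))//.
by rewrite /F2 /lin_p /lin mulr_natl cos2pi sin2pi cos0 sin0 subrr.
Qed.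

End fixed.

End rotation.

(** * Differentiation under the integral sign along a ray *)

Section derivative_along_ray.
Context {R : realType}.
Implicit Types (theta : 'cV[R]_3) (f : 'cV[R]_3 -> R).

Lemma sphere_regular_exp_dotv theta f : sphere_regular f ->
  sphere_regular (fun x => f x * expR (dotv theta x)).
Proof.
move=> rf; apply: sphere_regularM => //.
exact/sphere_regular_expR/sphere_regular_dotv.
Qed.

Lemma dotvZl n (k : R) (u v : 'cV[R]_n) : dotv (k *: u) v = k * dotv u v.
Proof. by rewrite /dotv mulr_sumr; apply: eq_bigr => i _; rewrite mxE mulrA. Qed.

(** Used with [f] equal to 1 and to theta . x, it shows that along the ray the derivative of Z is
    theta . M and that of theta . M is theta . S theta. *)
Lemma is_derive_integral_sphere theta f (s : R) : sphere_regular f ->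
  is_derive s (1 : R)
    (fun r => integral_sphere (fun x => f x * expR (dotv (r *: theta) x)))
    (integral_sphere (fun x =>
       f x * dotv theta x * expR (dotv (s *: theta) x))).
Proof.
move=> rf.
have [_ [M fM] _] := rf.
have [_ [N tN] _] := sphere_regular_dotv theta.
pose F (r : R) (x : borelR3 R) : R := f x * expR (dotv (r *: theta) x).
(* A constant dominating the derivative for all [r] within distance 1 of [s], where |r| is at most
   |s| + 1. Absolute values of [M] and [N] are taken because the bounds are not known to be
   nonnegative. *)
pose G (x : borelR3 R) : R := `|M| * `|N| * expR ((`|s| + 1) * `|N|).
have dF (r : R) x : is_derive r (1 : R) (F ^~ x)
    (f x * dotv theta x * expR (dotv (r *: theta) x)).
  rewrite (_ : F ^~ x = fun r => f x * expR (r * dotv theta x)); last first.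
    by apply/funext => q; rewrite /F dotvZl.
  apply: is_derive_eq.
  by rewrite /GRing.scale/= dotvZl; ring.
have Is : `]s - 1, s + 1[%classic s.
  by rewrite /= in_itv/=; apply/andP; split; lra.
have intF (r : R) : `]s - 1, s + 1[%classic r ->
    (sphere_measure R).-integrable sphere (EFin \o F r).
  by move=> _; exact/sphere_regular_integrable/sphere_regular_exp_dotv.
have derF (r : R) x : `]s - 1, s + 1[%classic r -> sphere x -> derivable (F ^~ x) r 1.
  by move=> _ _; case: (dF r x).
have G0 x : 0 <= G x by rewrite /G !mulr_ge0// expR_ge0.
have intG : (sphere_measure R).-integrable sphere (EFin \o G).
  by apply: sphere_regular_integrable; exact: sphere_regular_cst.
have FG (r : R) x : `]s - 1, s + 1[%classic r -> sphere x ->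
    `|partial1of2 F r x| <= G x.
  move=> /= + Sx; rewrite in_itv/= => /andP[sr rs].
  rewrite partial1of2E derive_val /G !normrM.
  have fMx := le_trans (fM _ Sx) (ler_norm M).
  have tNx := le_trans (tN _ Sx) (ler_norm N).
  rewrite ler_pM ?mulr_ge0//; first by rewrite ler_pM.
  rewrite ger0_norm ?expR_ge0// ler_expR dotvZl.
  apply: le_trans (ler_norm _) _; rewrite normrM ler_pM//.
  rewrite ler_norml; have := ler_norm s; have := ler_norm (- s).
  by rewrite normrN => ? ?; apply/andP; split; lra.
have mS := @measurable_sphere R.
have dI := derivable_under_integral mS Is intF derF G0 intG FG.
have vI := differentiation_under_integral mS Is intF derF G0 intG FG.
apply: DeriveDef; first exact: dI.
rewrite -derive1E; apply: etrans vI _.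
by apply: eq_Rintegral => x _; rewrite /= partial1of2E derive_val.
Qed.

End derivative_along_ray.

(** * Relations between the moments of exp (theta . x) on the sphere *)

Section exponential_moments.
Context {R : realType}.
Implicit Types (theta u v : 'cV[R]_3) (i j : 'I_3).

Definition exp_mass theta := integral_sphere (fun x => expR (dotv theta x)).

Definition exp_moment1 theta : 'cV[R]_3 :=
  \col_i integral_sphere (fun x => x i 0 * expR (dotv theta x)).

Definition exp_moment2 theta : 'M[R]_3 :=
  \matrix_(i, j) integral_sphere (fun x => x i 0 * x j 0 * expR (dotv theta x)).

Let regular1 theta i (c : R) :
  sphere_regular (fun x => c * (x i 0 * expR (dotv theta x))).
Proof.
apply: sphere_regularM; first exact: sphere_regular_cst.
exact/sphere_regular_exp_dotv/sphere_regular_coord.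
Qed.

Let regular2 theta i j (c : R) :
  sphere_regular (fun x => c * (x i 0 * x j 0 * expR (dotv theta x))).
Proof.
apply: sphere_regularM; first exact: sphere_regular_cst.
by apply/sphere_regular_exp_dotv/sphere_regularM; exact: sphere_regular_coord.
Qed.

Lemma sphere_regular_sum (F : 'I_3 -> 'cV[R]_3 -> R) :
  (forall i, sphere_regular (F i)) -> sphere_regular (fun x => \sum_i F i x).
Proof.
move=> rF; under eq_fun do rewrite sum3E.
by apply: sphere_regularD => //; exact: sphere_regularD.
Qed.

Lemma integral_sphere_sum (F : 'I_3 -> 'cV[R]_3 -> R) :
  (forall i, sphere_regular (F i)) ->
  integral_sphere (fun x => \sum_i F i x) = \sum_i integral_sphere (F i).
Proof.
move=> rF; under [in LHS]eq_fun do rewrite sum3E.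
by rewrite sum3E !integral_sphereD//; exact: sphere_regularD.
Qed.

Lemma exp_moment1E theta u :
  integral_sphere (fun x => dotv u x * expR (dotv theta x)) =
  dotv u (exp_moment1 theta).
Proof.
transitivity (integral_sphere (fun x =>
    \sum_i u i 0 * (x i 0 * expR (dotv theta x)))).
  apply: eq_integral_sphere => x _; rewrite mulr_suml.
  by apply: eq_bigr => i _; rewrite mulrA.
rewrite integral_sphere_sum//; apply: eq_bigr => i _.
rewrite mxE integral_sphereZ//.
exact/sphere_regular_exp_dotv/sphere_regular_coord.
Qed.

Lemma exp_moment2E theta u v :
  integral_sphere (fun x => dotv u x * dotv v x * expR (dotv theta x)) =
  dotv u (exp_moment2 theta *m v).
Proof.
transitivity (integral_sphere (fun x =>
    \sum_i \sum_j u i 0 * v j 0 * (x i 0 * x j 0 * expR (dotv theta x)))).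
  apply: eq_integral_sphere => x _; rewrite /dotv mulr_suml mulr_suml.
  apply: eq_bigr => i _; rewrite mulr_sumr mulr_suml.
  by apply: eq_bigr => j _; ring.
rewrite integral_sphere_sum => [|i]; last exact: sphere_regular_sum.
apply: eq_bigr => i _; rewrite integral_sphere_sum// mxE mulr_sumr.
apply: eq_bigr => j _; rewrite mxE integral_sphereZ; first by ring.
by apply/sphere_regular_exp_dotv/sphere_regularM; exact: sphere_regular_coord.
Qed.

Lemma exp_moment2_sym theta i j : exp_moment2 theta i j = exp_moment2 theta j i.
Proof. by rewrite !mxE; apply: eq_integral_sphere => x _; ring. Qed.

Lemma exp_moment2_trace theta : \tr (exp_moment2 theta) = exp_mass theta.
Proof.
rewrite /mxtrace; under eq_bigr do rewrite mxE.
rewrite -integral_sphere_sum => [|i]; last first.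
  by apply/sphere_regular_exp_dotv/sphere_regularM; exact: sphere_regular_coord.
apply: eq_integral_sphere => x /sphereP x1.
by rewrite -mulr_suml -[X in X * _]/(dotv x x) x1 mul1r.
Qed.

(** The rotation identity for the function exp (theta . x) itself, that is, with [u] zero and [c]
    one. *)
Lemma exp_moment1_cross theta v :
  dotv (crossv theta v) (exp_moment1 theta) = 0.
Proof.
rewrite -exp_moment1E -[RHS](integral_sphere_rotation theta 0 v 1).
apply: eq_integral_sphere => x _; congr (_ * _).
by rewrite !dotv3 !mxE; ring.
Qed.

(** The rotation identity for the function (u . x) exp (theta . x), that is, with [c] zero. *)
Lemma exp_moment2_cross theta u v :
  dotv u (exp_moment2 theta *m crossv theta v) =
  - dotv (crossv u v) (exp_moment1 theta).
Proof.
rewrite -exp_moment1E -exp_moment2E; apply/eqP; rewrite -addr_eq0 addrC; apply/eqP.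
rewrite -integral_sphereD.
- rewrite -[RHS](integral_sphere_rotation theta u v 0).
  by apply: eq_integral_sphere => x _; rewrite add0r mulrDl.
- exact/sphere_regular_exp_dotv/sphere_regular_dotv.
- by apply/sphere_regular_exp_dotv/sphere_regularM; exact: sphere_regular_dotv.
Qed.

(* Summing exp_moment2_cross over u := e_k and v := e_k ^ u gives the divergence
   theorem for the tangential part of the constant field u. *)
Lemma exp_moment2_mul theta u :
  dotv u (exp_moment2 theta *m theta) =
  dotv u theta * exp_mass theta - 2 * dotv u (exp_moment1 theta).
Proof.
have H k := exp_moment2_cross theta (delta_mx k 0) (crossv (delta_mx k 0) u).
have := H 0; have := H 1; have := H 2.
have := exp_moment2_trace theta; have S := exp_moment2_sym theta.
rewrite /mxtrace sum3E => <-.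
rewrite !dotv3; move: (exp_moment2 theta) (exp_moment1 theta) S => S M S_sym.
rewrite !mxE !sum3E !mxE !I3D/=.
have := S_sym 0 1; have := S_sym 0 2; have := S_sym 1 2 => -> -> ->.
lra.
Qed.

End exponential_moments.

(** * The exponential mass in closed form *)

Section exponential_mass.
Context {R : realType}.
Implicit Types theta : 'cV[R]_3.

(** The initial value, at the origin of each ray, for the differential equation of the mass. *)
Lemma exp_mass0 : exp_mass (0 : 'cV[R]_3) = 4 * pi.
Proof.
transitivity (integral_sphere (fun=> (1 : R))).
  apply: eq_integral_sphere => x _; rewrite dotv3 !mxE.
  by rewrite !mul0r !addr0 expR0.
rewrite /integral_sphere Rintegral_cst; last exact: measurable_sphere.
rewrite mul1r.
transitivity (fine (sphere_measure R (@sphere R))); first by [].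
by rewrite sphere_measure_sphere.
Qed.

(* Along the ray r |-> r theta, the function u r = r Z (r theta) satisfies
   u'' = s^2 u, so that (u' + s u) exp (- s r) is constant. *)
Lemma exp_mass_ode theta (s : R) : s ^+ 2 = dotv theta theta ->
  exp_mass theta + dotv theta (exp_moment1 theta) + s * exp_mass theta =
  4 * pi * expR s.
Proof.
move=> s2; pose Z r := exp_mass (r *: theta).
pose q r := dotv theta (exp_moment1 (r *: theta)).
pose q' r := dotv theta (exp_moment2 (r *: theta) *m theta).
have dZ (r : R) : is_derive r (1 : R) Z (q r).
  have := is_derive_integral_sphere theta r (sphere_regular_cst 1).
  rewrite (_ : (fun _ => _) = Z); last first.
    by apply/funext => y; apply: eq_integral_sphere => x _; rewrite mul1r.
  by rewrite /q -exp_moment1E; under eq_fun do rewrite mul1r.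
have dq (r : R) : is_derive r (1 : R) q (q' r).
  have := is_derive_integral_sphere theta r (sphere_regular_dotv theta).
  rewrite (_ : (fun r : R => _) = q); last first.
    by apply/funext => y; rewrite /q -exp_moment1E.
  by rewrite /q' -exp_moment2E.
(* The moment relation at [r *: theta], paired with [theta]. It determines the product [r * q' r],
   which is exactly what the derivative of [W] contains, so r = 0 is no special case. *)
have q'E r : r * q' r = r * s ^+ 2 * Z r - 2 * q r.
  have := exp_moment2_mul (r *: theta) theta.
  rewrite -/(q r) -/(Z r) s2 -scalemxAr => /esym.
  have dotvZr (k : R) (u v : 'cV[R]_3) : dotv u (k *: v) = k * dotv u v.
    by rewrite !dotv3 !mxE; ring.
  by rewrite !dotvZr -/(q' r).
pose W r := (Z r + r * q r + s * (r * Z r)) * expR (- s * r).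
have dW (r : R) : is_derive r (1 : R) W 0.
  rewrite /W; apply: is_derive_eq.
  rewrite /GRing.scale/=.
  transitivity ((r * q' r - (r * s ^+ 2 * Z r - 2 * q r)) * expR (- s * r)); first by ring.
  by rewrite q'E subrr mul0r.
have := is_derive_0_is_cst 1 0 dW.
rewrite /W /Z /q scale1r !mul1r scale0r exp_mass0 !mul0r !mulr0 !addr0 mulr1.
rewrite expR0 mulr1 => <-.
by rewrite -mulrA -expRD addNr expR0 mulr1.
Qed.

Definition cosh (r : R) : R := (expR r + expR (- r)) / 2.

(** Both square roots of theta . theta are admissible in [exp_mass_ode]; half the difference of the
    instances s = |theta| and s = -|theta| leaves the hyperbolic sine. *)
Lemma exp_mass_sinh theta :
  enorm theta * exp_mass theta = 4 * pi * sinh (enorm theta).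
Proof.
have r2 : enorm theta ^+ 2 = dotv theta theta by rewrite sqr_sqrtr// dotvv_ge0.
have := exp_mass_ode r2; rewrite -sqrrN in r2; have := exp_mass_ode r2.
rewrite /sinh; move: (expR _) (expR _) => a b; lra.
Qed.

(** Half the sum of the same two instances. *)
Lemma exp_moment1_cosh theta :
  exp_mass theta + dotv theta (exp_moment1 theta) = 4 * pi * cosh (enorm theta).
Proof.
have r2 : enorm theta ^+ 2 = dotv theta theta by rewrite sqr_sqrtr// dotvv_ge0.
have := exp_mass_ode r2; rewrite -sqrrN in r2; have := exp_mass_ode r2.
rewrite /cosh; move: (expR _) (expR _) => a b; lra.
Qed.

End exponential_mass.

(** * Hyperbolic inequalities and the first two derivatives of [kappa] *)

Section kappa_derivatives.
Context {R : realType}.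
Implicit Types r : R.

Lemma cosh2Bsinh2 r : cosh r ^+ 2 - sinh r ^+ 2 = 1.
Proof.
transitivity (expR r * expR (- r)); first by rewrite /cosh /sinh; field.
by rewrite -expRD subrr expR0.
Qed.

Lemma is_derive_sinh r : is_derive r (1 : R) (@sinh R) (cosh r).
Proof.
rewrite /sinh; apply: is_derive_eq; rewrite /GRing.scale/= /cosh; by field.
Qed.

Lemma is_derive_cosh r : is_derive r (1 : R) (@cosh R) (sinh r).
Proof.
rewrite /cosh; apply: is_derive_eq; rewrite /GRing.scale/= /sinh; by field.
Qed.

Lemma sinh_gt0 r : 0 < r -> 0 < sinh r.
Proof. by move=> r0; rewrite /sinh divr_gt0// subr_gt0 ltr_expR; lra. Qed.

Lemma sinh0 : sinh 0 = 0 :> R.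
Proof. by rewrite /sinh oppr0 subrr mul0r. Qed.

(** The strict inequality 1 + x < exp x is added up at x = r and x = -r. *)
Lemma cosh_gt1 r : 0 < r -> 1 < cosh r.
Proof.
move=> r0; rewrite /cosh.
have := @expR_gt1Dx R r; have := @expR_gt1Dx R (- r).
rewrite oppr_eq0 gt_eqF// => /(_ isT) + /(_ isT); lra.
Qed.

Lemma sinh_gt_id r : 0 < r -> r < sinh r.
Proof.
move=> r0.
have cs : {within `[0, r], continuous (@sinh R)}.
  by apply: continuous_subspaceT; exact: is_derive_continuous is_derive_sinh.
have [c] := MVT r0 (fun x _ => is_derive_sinh x) cs.
rewrite in_itv/= => /andP[c0 cr]; rewrite sinh0 !subr0 => ->.
by rewrite -ltr_pdivrMr// divff ?gt_eqF// cosh_gt1.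
Qed.

(** The mean value theorem for x cosh x - sinh x, which vanishes at 0 and has the positive
    derivative x sinh x. *)
Lemma sinh_lt_mul_cosh r : 0 < r -> sinh r < r * cosh r.
Proof.
move=> r0; pose f (x : R) := x * cosh x - sinh x.
have df (x : R) : is_derive x (1 : R) f (x * sinh x).
  have := is_derive_sinh x; have := is_derive_cosh x => ? ?.
  by rewrite /f; apply: is_derive_eq; rewrite /GRing.scale/=; ring.
have cf : {within `[0, r], continuous f}.
  by apply: continuous_subspaceT; exact: is_derive_continuous df.
have [c] := MVT r0 (fun x _ => df x) cf.
rewrite in_itv/= => /andP[c0 cr]; rewrite /f sinh0 mul0r !subr0 => fr.
by have sc := sinh_gt0 c0; rewrite -subr_gt0 fr; apply: mulr_gt0 => //; exact: mulr_gt0.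
Qed.

Lemma is_derive_kappa r : 0 < r ->
  is_derive r (1 : R) (@kappa R) (cosh r / sinh r - r^-1).
Proof.
move=> r0; have := is_derive_sinh r; have := sinh_gt0 r0 => s0 ds.
have dls : is_derive r (1 : R) (fun x => ln (sinh x)) ((sinh r)^-1 * cosh r).
  by apply: is_derive1_comp; exact: is_derive1_ln.
have dl := is_derive1_ln r0.
by rewrite /kappa; apply: is_derive_eq; ring.
Qed.

Lemma derive1_kappa r : 0 < r ->
  derive1 (@kappa R) r = cosh r / sinh r - r^-1.
Proof. by move=> /is_derive_kappa dk; rewrite derive1E derive_val. Qed.

Lemma derive1_derive1_kappa r : 0 < r ->
  derive1 (derive1 (@kappa R)) r = r ^- 2 - (sinh r) ^- 2.
Proof.
move=> r0; have s0 := sinh_gt0 r0.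
(* The formula for the first derivative is available at positive arguments, hence in a neighbourhood
   of [r], which suffices for differentiating once more. *)
rewrite derive1E (@near_eq_derive _ _ _ _ (fun x : R => cosh x * (sinh x)^-1 - x^-1)).
- have dV : is_derive r (1 : R) (fun x => (sinh x)^-1) _ :=
    is_deriveV (lt0r_neq0 s0) (is_derive_sinh r).
  have dVi : is_derive r (1 : R) (fun x => x^-1) _ :=
    is_deriveV (lt0r_neq0 r0) (is_derive_id r 1).
  have dc := is_derive_cosh r.
  rewrite derive_val /GRing.scale/=.
  transitivity (r ^- 2 - (cosh r ^+ 2 - sinh r ^+ 2) / sinh r ^+ 2); last first.
    by rewrite cosh2Bsinh2 mul1r.
  by field; rewrite !lt0r_neq0.
- near=> x; apply: derive1_kappa; near: x; exact: lt_nbhsr.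
Unshelve. all: by end_near. Qed.

(** Clearing denominators reduces this to [sinh_lt_mul_cosh]. With the positivity of the second
    derivative it makes the Fisher matrix invertible. *)
Lemma derive1_kappa_gt0 r : 0 < r -> 0 < derive1 (@kappa R) r.
Proof.
move=> r0; rewrite derive1_kappa// subr_gt0 ltr_pdivlMr ?sinh_gt0//.
by rewrite mulrC ltr_pdivrMr// mulrC sinh_lt_mul_cosh.
Qed.

Lemma derive1_derive1_kappa_gt0 r : 0 < r -> 0 < derive1 (derive1 (@kappa R)) r.
Proof.
move=> r0; rewrite derive1_derive1_kappa// subr_gt0 ltf_pV2 ?posrE ?exprn_gt0 ?sinh_gt0//.
by rewrite ltr_pXn2r ?nnegrE ?ltW ?sinh_gt0// sinh_gt_id.
Qed.

(* The Riccati equation of the Langevin function coth r - 1/r. *)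
Lemma kappa_riccati r : 0 < r -> derive1 (derive1 (@kappa R)) r =
  1 - 2 * derive1 (@kappa R) r / r - derive1 (@kappa R) r ^+ 2.
Proof.
move=> r0; have s0 := sinh_gt0 r0.
rewrite derive1_derive1_kappa// derive1_kappa//.
transitivity (r ^- 2 - (cosh r ^+ 2 - sinh r ^+ 2) / sinh r ^+ 2).
  by rewrite cosh2Bsinh2 mul1r.
by field; rewrite !lt0r_neq0.
Qed.

End kappa_derivatives.

(** * Mean and covariance of the von Mises-Fisher densities *)

Section von_mises_fisher_moments.
Context {R : realType}.
Implicit Types theta u v x : 'cV[R]_3.

Lemma dotvC n (u v : 'cV[R]_n) : dotv u v = dotv v u.
Proof. by rewrite /dotv; apply: eq_bigr => i _; rewrite mulrC. Qed.

Lemma dotv_delta (u : 'cV[R]_3) i : dotv u (delta_mx i 0) = u i 0.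
Proof. by rewrite dotv3 !mxE; case: (I3P i) => -> /=; ring. Qed.

Lemma dotv_mul_tr n (u v : 'cV[R]_n) : u^T *m v = (dotv u v)%:M.
Proof.
apply/matrixP => i j; rewrite !ord1 !mxE eqxx mulr1n.
by apply: eq_bigr => k _; rewrite mxE.
Qed.

Lemma sqr_enorm n (u : 'cV[R]_n) : enorm u ^+ 2 = dotv u u.
Proof. by rewrite sqr_sqrtr// dotvv_ge0. Qed.

Lemma dotvv_gt0 n (u : 'cV[R]_n) : u != 0 -> 0 < dotv u u.
Proof.
move=> u0; rewrite lt_def dotvv_ge0 andbT; apply: contra u0 => /eqP uu.
apply/eqP/matrixP => i j; rewrite ord1 mxE.
apply/eqP; rewrite -[_ == 0]orbb -mulf_eq0; apply/eqP.
by apply: psumr_eq0P uu i _ => // k _; rewrite -expr2 sqr_ge0.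
Qed.

Lemma enorm_gt0 n (u : 'cV[R]_n) : u != 0 -> 0 < enorm u.
Proof. by move=> u0; rewrite sqrtr_gt0 dotvv_gt0. Qed.

Section nonzero_parameter.
Variable theta : 'cV[R]_3.
Hypothesis theta_neq0 : theta != 0.

Let r := enorm theta.
Let K1 := derive1 (@kappa R) r.
Let K2 := derive1 (derive1 (@kappa R)) r.
Let Z := exp_mass theta.

Let r_gt0 : 0 < r. Proof. exact: enorm_gt0. Qed.

Let pi4_gt0 : 0 < 4 * pi :> R. Proof. by rewrite mulr_gt0// pi_gt0. Qed.

Let ZE : Z = 4 * pi * sinh r / r.
Proof. by rewrite -exp_mass_sinh mulrAC divff ?mul1r// gt_eqF. Qed.

Let Z_gt0 : 0 < Z.
Proof. by rewrite ZE divr_gt0// mulr_gt0// sinh_gt0. Qed.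

(** For r = |theta| > 0, [kappa r] is the logarithm of 4 pi sinh r / r, which is the mass computed
    above. *)
Lemma vmfE x : vmf theta x = (exp_mass theta)^-1 * expR (dotv theta x).
Proof.
rewrite /vmf expRB mulrC; congr (_^-1 * _).
rewrite -/r -/Z ZE /kappa !expRD expRN !lnK ?posrE ?sinh_gt0//.
by rewrite -mulrA mulrC.
Qed.

Lemma vmf_cst : integral_sphere (vmf theta) = 1.
Proof.
rewrite (eq_integral_sphere (fun x _ => vmfE x)).
rewrite integral_sphereZ; last exact/sphere_regular_expR/sphere_regular_dotv.
by rewrite -/(exp_mass theta) mulVf// gt_eqF.
Qed.

(** Since Z + theta . M = 4 pi cosh r, the moment is Z (r coth r - 1), and [K1] is coth r - 1 /
    r. *)
Let radial_moment : dotv theta (exp_moment1 theta) = Z * (r * K1).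
Proof.
have -> : dotv theta (exp_moment1 theta) = 4 * pi * cosh r - Z.
  by rewrite -exp_moment1_cosh addrAC subrr add0r.
rewrite /K1 derive1_kappa// ZE; field.
by rewrite !lt0r_neq0// sinh_gt0.
Qed.

(** M is parallel to [theta]: the field theta ^ (theta ^ u) integrates to zero, and the triple
    product formula turns this into r^2 (u . M) = (u . theta) (theta . M). *)
Let moment1 u : dotv u (exp_moment1 theta) = Z * (K1 / r * dotv u theta).
Proof.
have := exp_moment1_cross theta (crossv theta u).
have -> : dotv (crossv theta (crossv theta u)) (exp_moment1 theta) =
    dotv u theta * dotv theta (exp_moment1 theta) -
    dotv theta theta * dotv u (exp_moment1 theta).
  by rewrite !dotv3 !mxE !I3D; ring.
rewrite radial_moment -sqr_enorm -/r => /eqP; rewrite subr_eq0 => /eqP H.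
apply: (@mulfI _ (r ^+ 2)); first by rewrite expf_neq0// gt_eqF.
by rewrite -H; field; rewrite gt_eqF.
Qed.

Lemma vmf_mean u :
  integral_sphere (fun x => dotv u x * vmf theta x) = K1 / r * dotv u theta.
Proof.
transitivity (integral_sphere (fun x => Z^-1 * (dotv u x * expR (dotv theta x)))).
  by apply: eq_integral_sphere => x _; rewrite vmfE mulrCA.
rewrite integral_sphereZ; last exact/sphere_regular_exp_dotv/sphere_regular_dotv.
by rewrite exp_moment1E moment1 mulKf// gt_eqF.
Qed.

(** With w = theta ^ v, the vector r^2 v is (v . theta) theta - theta ^ w. The first term is handled
    by [exp_moment2_mul] and the second by [exp_moment2_cross]. The coefficient 1 - 3 K1 / r is the
    one that gives S / Z the trace 1. *)
Let moment2 u v : dotv u (exp_moment2 theta *m v) =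
  Z * (K1 / r * dotv u v +
       (1 - 3 * K1 / r) / r ^+ 2 * (dotv u theta * dotv v theta)).
Proof.
pose w := crossv theta v.
have r2v : r ^+ 2 *: v + crossv theta w = dotv v theta *: theta.
  apply/matrixP => i j; rewrite ord1 /w /r sqr_enorm !dotv3 !mxE.
  by case: (I3P i) => ->; rewrite !I3D /=; ring.
have H := exp_moment2_cross theta u w.
have uw : dotv (crossv u w) theta = r ^+ 2 * dotv u v - dotv u theta * dotv v theta.
  by rewrite /w /r sqr_enorm !dotv3 !mxE !I3D; ring.
apply: (@mulfI _ (r ^+ 2)); first by rewrite expf_neq0// gt_eqF.
have dotvDr (a b : 'cV[R]_3) : dotv u (a + b) = dotv u a + dotv u b.
  by rewrite !dotv3 !mxE; ring.
have dotvZr (k : R) (a : 'cV[R]_3) : dotv u (k *: a) = k * dotv u a.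
  by rewrite dotvC dotvZl dotvC.
have := congr1 (fun w => dotv u (exp_moment2 theta *m w)) r2v.
rewrite mulmxDr -!scalemxAr dotvDr !dotvZr H exp_moment2_mul !moment1 uw -/Z.
move=> /(canRL (addrK _)) ->.
by field; rewrite gt_eqF.
Qed.

Lemma vmf_second_moment u v :
  integral_sphere (fun x => dotv u x * dotv v x * vmf theta x) =
  K1 / r * dotv u v + (1 - 3 * K1 / r) / r ^+ 2 * (dotv u theta * dotv v theta).
Proof.
transitivity (integral_sphere (fun x =>
    Z^-1 * (dotv u x * dotv v x * expR (dotv theta x)))).
  by apply: eq_integral_sphere => x _; rewrite vmfE mulrCA.
rewrite integral_sphereZ; last first.
  by apply/sphere_regular_exp_dotv/sphere_regularM; exact: sphere_regular_dotv.
by rewrite exp_moment2E moment2 mulKf// gt_eqF.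
Qed.

Lemma sphere_regular_vmf : sphere_regular (vmf theta).
Proof.
have -> : vmf theta = (fun x => Z^-1 * expR (dotv theta x)).
  by apply/funext => x; exact: vmfE.
apply: sphere_regular_exp_dotv; exact: sphere_regular_cst.
Qed.

(** In the unit direction of [theta] the centred second moment is 1 - 2 K1 / r - K1^2, and the
    Riccati equation identifies it with [K2]. *)
Lemma vmf_covariance u v :
  integral_sphere (fun x => (dotv u x - K1 / r * dotv u theta) *
    (dotv v x - K1 / r * dotv v theta) * vmf theta x) =
  K1 / r * dotv u v + (K2 - K1 / r) / r ^+ 2 * (dotv u theta * dotv v theta).
Proof.
have rv := sphere_regular_vmf; have rl w := sphere_regular_dotv w.
pose a := K1 / r * dotv u theta; pose b := K1 / r * dotv v theta.
transitivity (integral_sphere (fun x => dotv u x * dotv v x * vmf theta x +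
    ((- b) * (dotv u x * vmf theta x) +
     ((- a) * (dotv v x * vmf theta x) + (a * b) * vmf theta x)))).
  by apply: eq_integral_sphere => x _; rewrite -/a -/b; ring.
have rc := sphere_regular_cst.
rewrite !integral_sphereD ?integral_sphereZ; do ?[
  by repeat first [exact: rv | exact: rl | exact: rc |
    apply: sphere_regularM | apply: sphere_regularD]].
rewrite vmf_second_moment !vmf_mean vmf_cst /K2 kappa_riccati// -/K1 /a /b.
by field; rewrite gt_eqF.
Qed.

End nonzero_parameter.

End von_mises_fisher_moments.

(** * Reduction of derivatives to one real variable and to coordinates *)

Section directional_derivatives.
Context {R : realType}.

(** Turns a directional derivative on a normed space into one of a function of a real variable,
    where instance resolution computes it. *)
Lemma is_derive_line (V : normedModType R) (f : V -> R) (a v : V) (d : R) :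
  is_derive (0 : R) 1 (fun h : R => f (h *: v + a)) d -> is_derive a v f d.
Proof.
move=> [dfl fl].
have E : (fun h : R => h^-1 *: (((fun h : R => f (h *: v + a)) \o shift 0) (h *: 1) -
    f (0 *: v + a))) = (fun h : R => h^-1 *: ((f \o shift a) (h *: v) - f a)).
  apply/funext => h /=; rewrite scale0r add0r addr0.
  by have -> : h *: (1 : R) = h by exact: mulr1.
split; first by move: dfl; rewrite /derivable E.
by move: fl; rewrite /derive E.
Qed.

Lemma is_derive_colP n (f : R -> 'cV[R]_n) (t : R) (d : 'cV[R]_n) :
  is_derive t 1 f d <->
  (forall i, is_derive t (1 : R) (fun s => f s i 0) (d i 0)).
Proof.
split=> [[df <-] i|df].
  split; first by have /derivable_mxP := df; exact.
  by rewrite derive_mx// mxE.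
have dft : derivable f t 1.
  by apply/derivable_mxP => i j; rewrite ord1; case: (df i).
split=> //; rewrite derive_mx//; apply/matrixP => i j.
by rewrite !mxE ord1; case: (df i).
Qed.

End directional_derivatives.

(** * Scores, tangent vectors and Fisher matrix of the family *)

Section vmf_derivatives.
Context {R : realType}.
Implicit Types theta x : 'cV[R]_3.

Definition log_vmf theta x : R := dotv theta x - kappa (enorm theta).

(** Stated along a curve so as to serve both the coordinate lines of the partial derivatives and,
    through [is_derive_sqrt_density], the curve [thetaF]. *)
Lemma is_derive_log_vmf (g : R -> 'cV[R]_3) (t : R) (d x : 'cV[R]_3) :
  is_derive t 1 g d -> g t != 0 ->
  is_derive t (1 : R) (fun s => log_vmf (g s) x)
    (dotv d x - derive1 (@kappa R) (enorm (g t)) / enorm (g t) * dotv (g t) d).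
Proof.
move=> /is_derive_colP dg gt0; have r0 := enorm_gt0 gt0.
have d0 := dg 0; have d1 := dg 1; have d2 := dg 2.
have dl : is_derive t (1 : R) (fun s => dotv (g s) x) (dotv d x).
  under eq_fun do rewrite dotv3.
  by apply: is_derive_eq; rewrite dotv3 /GRing.scale/=; ring.
have dn : is_derive t (1 : R) (fun s => dotv (g s) (g s)) (2 * dotv (g t) d).
  under eq_fun do rewrite dotv3.
  by apply: is_derive_eq; rewrite dotv3 /GRing.scale/=; ring.
have dr : is_derive t (1 : R) (fun s => enorm (g s)) ((enorm (g t))^-1 * dotv (g t) d).
  have ds := is_derive1_sqrt (dotvv_gt0 gt0).
  apply: (is_derive_eq (is_derive1_comp ds dn)).
  by rewrite -/(enorm (g t)); field; rewrite gt_eqF.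
have dk : is_derive t (1 : R) (fun s => kappa (enorm (g s)))
    (derive1 (@kappa R) (enorm (g t)) * ((enorm (g t))^-1 * dotv (g t) d)).
  by apply: is_derive1_comp; rewrite derive1_kappa//; exact: is_derive_kappa.
by rewrite /log_vmf; apply: is_derive_eq; ring.
Qed.

Lemma ln_vmf theta x : ln (vmf theta x) = log_vmf theta x.
Proof. exact: expRK. Qed.

(** Halving the exponent replaces the square root by an exponential, whose logarithm also gives the
    log-density back. *)
Lemma sqrt_density_vmf theta x :
  sqrt_density (@vmf R) theta x = expR (log_vmf theta x / 2).
Proof.
rewrite /sqrt_density /vmf -/(log_vmf theta x).
by rewrite [in LHS](splitr (log_vmf theta x)) expRD -expr2 sqrtr_sqr ger0_norm ?expR_ge0.
Qed.

Lemma sqrt_density_gt0 theta x : 0 < sqrt_density (@vmf R) theta x.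
Proof. by rewrite sqrt_density_vmf expR_gt0. Qed.

Lemma sqr_sqrt_density theta x : sqrt_density (@vmf R) theta x ^+ 2 = vmf theta x.
Proof. by rewrite sqr_sqrtr// expR_ge0. Qed.

Lemma is_derive_sqrt_density (g : R -> 'cV[R]_3) (t : R) (d x : 'cV[R]_3) :
  is_derive t 1 g d -> g t != 0 ->
  is_derive t (1 : R) (fun s => sqrt_density (@vmf R) (g s) x)
    (sqrt_density (@vmf R) (g t) x / 2 *
     (dotv d x - derive1 (@kappa R) (enorm (g t)) / enorm (g t) * dotv (g t) d)).
Proof.
move=> dg gt0; have dl := is_derive_log_vmf x dg gt0.
under eq_fun do rewrite sqrt_density_vmf.
by apply: is_derive_eq; rewrite sqrt_density_vmf /GRing.scale/=; ring.
Qed.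

Let is_derive_affine theta v :
  is_derive (0 : R) 1 (fun h : R => h *: v + theta) v.
Proof.
apply/is_derive_colP => i.
rewrite (_ : (fun _ => _) = (fun h : R => h * v i 0 + theta i 0)); last first.
  by apply/funext => h; rewrite !mxE.
by apply: is_derive_eq; rewrite /GRing.scale/=; ring.
Qed.

Lemma partial_ln_vmf theta x i : theta != 0 ->
  partial i (fun th => ln (vmf th x)) theta =
  x i 0 - derive1 (@kappa R) (enorm theta) / enorm theta * theta i 0.
Proof.
move=> th0; apply: derive_val; apply: is_derive_line.
under eq_fun do rewrite ln_vmf.
have := is_derive_log_vmf x (is_derive_affine theta (delta_mx i 0)).
by rewrite scale0r add0r dotv_delta (dotvC _ x) dotv_delta; exact.
Qed.

Lemma tangent_vmf theta x i : theta != 0 ->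
  tangent (@vmf R) i theta x = sqrt_density (@vmf R) theta x / 2 *
    (x i 0 - derive1 (@kappa R) (enorm theta) / enorm theta * theta i 0).
Proof.
move=> th0; apply: derive_val; apply: is_derive_line.
have := is_derive_sqrt_density x (is_derive_affine theta (delta_mx i 0)).
by rewrite scale0r add0r dotv_delta (dotvC _ x) dotv_delta; exact.
Qed.

Lemma fisher_vmf theta : theta != 0 ->
  fisher (@vmf R) theta =
  (derive1 (@kappa R) (enorm theta) / enorm theta)%:M +
  ((derive1 (derive1 (@kappa R)) (enorm theta) -
    derive1 (@kappa R) (enorm theta) / enorm theta) / enorm theta ^+ 2) *:
    (theta *m theta^T).
Proof.
move=> th0; apply/matrixP => i j; rewrite [LHS]mxE.
pose e k : 'cV[R]_3 := delta_mx k 0.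
pose k1 := derive1 (@kappa R) (enorm theta) / enorm theta.
transitivity (integral_sphere (fun x => (dotv (e i) x - k1 * dotv (e i) theta) *
    (dotv (e j) x - k1 * dotv (e j) theta) * vmf theta x)).
  apply: eq_integral_sphere => x _.
  by rewrite !partial_ln_vmf// !(dotvC (e _)) !dotv_delta.
rewrite vmf_covariance// !(dotvC _ theta) !dotv_delta !mxE big_ord1 !mxE.
by rewrite eqxx andbT eq_sym mulr_natr.
Qed.

Lemma fisher_vmf_unit theta : theta != 0 -> fisher (@vmf R) theta \in unitmx.
Proof.
move=> th0; rewrite fisher_vmf//.
have r0 := enorm_gt0 th0.
have := derive1_kappa_gt0 r0; have := derive1_derive1_kappa_gt0 r0.
have : theta^T *m theta = (enorm theta ^+ 2)%:M by rewrite sqr_enorm dotv_mul_tr.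
move: (derive1 (derive1 (@kappa R)) (enorm theta)) => K2.
move: (derive1 (@kappa R) (enorm theta)) => K1.
move: (enorm theta) r0 => r r0 r2 K20 K10.
(* The candidate inverse has eigenvalue [r / K1] on the orthogonal of [theta] and [K2^-1] on
   [theta], the reciprocals of those of the Fisher matrix. *)
pose a := r / K1; pose b := (K2^-1 - r / K1) / r ^+ 2.
have := @mulmx1_unit _ _ _ (a%:M + b *: (theta *m theta^T)).
have TT : (theta *m theta^T) *m (theta *m theta^T) = r ^+ 2 *: (theta *m theta^T).
  by rewrite mulmxA -(mulmxA theta) r2 -scalemx1 -scalemxAr mulmx1 -scalemxAl.
move=> H; apply: (proj1 (H _ _)).
rewrite mulmxDl !mulmxDr -!scalemxAl -!scalemxAr TT !scalerA.
rewrite !mul_scalar_mx mul_mx_scalar !scalerA.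
rewrite scale_scalar_mx -addrA -!scalerDl.
rewrite (_ : _ * a = 1); last by rewrite /a; field; rewrite !gt_eqF.
rewrite [X in X *: _](_ : _ = 0) ?scale0r ?addr0//.
by rewrite /a /b; field; rewrite !gt_eqF.
Qed.

End vmf_derivatives.

(** * Smoothness of affine functions and of exponentials of linear forms *)

Section smooth_functions.
Context {R : realType}.
Implicit Types (u x v : 'cV[R]_3) (c d : R).

(* Stated on a topologicalType so that they apply on matrices, where the
   filter instance is not found when cvgD and cvgM are applied directly. *)
Lemma continuous_funD (T : topologicalType) (f g : T -> R) :
  continuous f -> continuous g -> continuous (fun y => f y + g y).
Proof. by move=> cf cg y; apply: cvgD; [exact: cf|exact: cg]. Qed.

Lemma continuous_funM (T : topologicalType) (f g : T -> R) :
  continuous f -> continuous g -> continuous (fun y => f y * g y).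
Proof. by move=> cf cg y; apply: cvgM; [exact: cf|exact: cg]. Qed.

Lemma continuous_dotv u : continuous (dotv u).
Proof.
have -> : dotv u = (fun x => u 0 0 * x 0 0 + u 1 0 * x 1 0 + u 2 0 * x 2 0).
  by apply/funext => x; rewrite dotv3.
have cM i : continuous (fun x : 'cV[R]_3 => u i 0 * x i 0).
  by apply: continuous_funM; [exact: cst_continuous|exact: coord_continuous].
by apply: continuous_funD => //; exact: continuous_funD.
Qed.

Lemma is_derive_dotv u x v : is_derive x v (dotv u) (dotv u v).
Proof.
apply: is_derive_line.
rewrite (_ : (fun _ => _) = (fun h : R => h * dotv u v + dotv u x)); last first.
  by apply/funext => h; rewrite !dotv3 !mxE; ring.
by apply: is_derive_eq; rewrite /GRing.scale/=; ring.
Qed.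

Lemma is_derive_affine u c d x v :
  is_derive x v (fun y => c * (dotv u y - d)) (c * dotv u v).
Proof.
have du := is_derive_dotv u x v.
by apply: is_derive_eq; rewrite /GRing.scale/=; ring.
Qed.

Lemma partial_affine u c d i :
  partial i (fun y => c * (dotv u y - d)) = cst (c * u i 0).
Proof.
apply/funext => x; apply: derive_val.
by rewrite -dotv_delta; exact: is_derive_affine.
Qed.

Lemma partial_cst n (i : 'I_n.+1) c : partial i (cst c) = cst 0.
Proof. by apply/funext => x; exact: derive_cst. Qed.

Lemma smooth_cst c : smooth (cst c : 'cV[R]_3 -> R).
Proof.
move=> k; elim: k c => [|k IH] c; first by split=> //; exact: cst_continuous.
split; first exact: cst_continuous.
by move=> i; split=> [x|]; [exact: derivable_cst|rewrite partial_cst; exact: IH].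
Qed.

(** The scores are affine in [x], so these are the test functions to which the adjoint relation is
    applied. *)
Lemma smooth_affine u c d : smooth (fun y => c * (dotv u y - d)).
Proof.
have cf : continuous (fun y => c * (dotv u y - d)).
  apply: continuous_funM; first exact: cst_continuous.
  by apply: continuous_funD; [exact: continuous_dotv|exact: cst_continuous].
case=> [|k]; first by split.
split=> // i; split=> [x|]; last by rewrite partial_affine; exact: smooth_cst.
by case: (is_derive_affine u c d x (delta_mx i 0)).
Qed.

Lemma is_derive_exp_dotv u c x v :
  is_derive x v (fun y => c * expR (dotv u y)) (c * dotv u v * expR (dotv u x)).
Proof.
apply: is_derive_line.
rewrite (_ : (fun _ => _) = (fun h : R => c * expR (h * dotv u v + dotv u x))); last first.
  apply/funext => h; congr (_ * expR _); rewrite !dotv3 !mxE; ring.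
apply: is_derive_eq; rewrite /GRing.scale/= mul0r add0r; ring.
Qed.

(** A partial derivative only changes the constant, so the induction on the order runs over all [c]
    at once. *)
Lemma smooth_exp_dotv u c : smooth (fun y => c * expR (dotv u y)).
Proof.
have cf c' : continuous (fun y => c' * expR (dotv u y)).
  apply: continuous_funM => [|x]; first exact: cst_continuous.
  apply: (@continuous_comp _ _ _ (dotv u) expR); first exact: continuous_dotv.
  exact: continuous_expR.
move=> k; elim: k c => [|k IH] c; first by split.
split=> // i; split=> [x|].
  by case: (is_derive_exp_dotv u c x (delta_mx i 0)).
rewrite (_ : partial _ _ = (fun y => (c * u i 0) * expR (dotv u y))) //.
apply/funext => x; apply: derive_val.
by rewrite -[u i 0]dotv_delta; exact: is_derive_exp_dotv.
Qed.

End smooth_functions.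

(** * The projection of the forward equation onto the tangent space *)

Section prediction.
Context {R : realType}.
Variables (Omega : R -> 'cV[R]_3) (gamma : R).
Implicit Types theta u x : 'cV[R]_3.

Lemma smooth_vmf theta : theta != 0 -> smooth (vmf theta).
Proof.
move=> th0; have -> : vmf theta = (fun x => (exp_mass theta)^-1 * expR (dotv theta x)).
  by apply/funext => x; exact: vmfE.
exact: smooth_exp_dotv.
Qed.

(** The Hessian vanishes, so only the drift acts; the triple product u . (Omega ^ x) = (u ^ Omega) .
    x makes the result a linear form in [x]. *)
Lemma generator_affine (t : R) u (c d : R) x :
  generator Omega gamma t (fun y => c * (dotv u y - d)) x =
  - c * dotv (crossv u (Omega t) + gamma ^+ 2 *: u) x.
Proof.
rewrite generatorE.
have -> : hessian (fun y => c * (dotv u y - d)) x = 0.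
  by apply/matrixP => i j; rewrite !mxE partial_affine partial_cst.
rewrite mulmx0 mxtrace0 mulr0 addr0.
have -> : gradient (fun y => c * (dotv u y - d)) x = c *: u.
  by apply/matrixP => i j; rewrite !mxE partial_affine ord1.
by rewrite !dotv3 !mxE !I3D; ring.
Qed.

Variable Ga : R -> ('cV[R]_3 -> R) -> 'cV[R]_3 -> R.
Hypothesis adjGa : forall t, formal_adjoint (generator Omega gamma t) (Ga t).

Lemma inner_sqrt_forward_tangent (t : R) theta i : theta != 0 ->
  inner_sphere (sqrt_forward (Ga t) (sqrt_density (@vmf R) theta))
    (tangent (@vmf R) i theta) =
  - (derive1 (@kappa R) (enorm theta) / enorm theta) / 4 *
  (crossv (Omega t) theta + gamma ^+ 2 *: theta) i 0.
Proof.
move=> th0; pose e : 'cV[R]_3 := delta_mx i 0.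
pose k := derive1 (@kappa R) (enorm theta) / enorm theta.
(* A quarter of the score. The forward term is [Ga t (vmf theta)] over twice the square-root density
   and the tangent vector is half that root times the score, so the roots cancel. *)
pose phi : 'cV[R]_3 -> R := fun x => 4^-1 * (dotv e x - k * theta i 0).
transitivity (inner_sphere phi (Ga t (vmf theta))).
  apply: eq_integral_sphere => x _.
  rewrite /sqrt_forward tangent_vmf// -/k /phi dotvC dotv_delta.
  rewrite (_ : (fun y => _) = vmf theta); last first.
    by apply/funext => y; rewrite sqr_sqrt_density.
  have := sqrt_density_gt0 theta x; move: (sqrt_density _ _ _) => s s0.
  by field; rewrite gt_eqF.
have [_ <-] := adjGa t (smooth_vmf th0); last exact: smooth_affine.
pose w := crossv e (Omega t) + gamma ^+ 2 *: e.
transitivity (integral_sphere (fun x => - 4^-1 * (dotv w x * vmf theta x))).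
  by apply: eq_integral_sphere => x _; rewrite generator_affine mulrA.
rewrite integral_sphereZ; last first.
  by apply: sphere_regularM; [exact: sphere_regular_dotv|exact: sphere_regular_vmf].
rewrite vmf_mean// -/k.
have -> : dotv w theta = (crossv (Omega t) theta + gamma ^+ 2 *: theta) i 0.
  by rewrite dotv3 /w /e !mxE; case: (I3P i) => ->; rewrite !I3D /=; ring.
by field.
Qed.

Definition vmf_prediction (t : R) theta : 'cV[R]_3 :=
  - crossv (Omega t) theta -
    (gamma ^+ 2 * derive1 (@kappa R) (enorm theta) /
     (enorm theta * derive1 (derive1 (@kappa R)) (enorm theta))) *: theta.

(** The linear system is checked rather than solved. The Fisher matrix multiplies Omega ^ theta,
    orthogonal to [theta], by kappa' / |theta|, and it multiplies [theta] by kappa'', which cancels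
    the denominator of the prediction. *)
Lemma fisher_vmf_prediction (t : R) theta : theta != 0 ->
  fisher (@vmf R) theta *m vmf_prediction t theta =
  - (derive1 (@kappa R) (enorm theta) / enorm theta) *:
    (crossv (Omega t) theta + gamma ^+ 2 *: theta).
Proof.
move=> th0; have r0 := enorm_gt0 th0.
have K10 := derive1_kappa_gt0 r0; have K20 := derive1_derive1_kappa_gt0 r0.
rewrite fisher_vmf// /vmf_prediction.
set K2 := derive1 (derive1 _) _ in K20 *; set K1 := derive1 _ _ in K10 *.
have r2 : theta^T *m theta = (enorm theta ^+ 2)%:M.
  by rewrite sqr_enorm dotv_mul_tr.
have r2O : theta^T *m crossv (Omega t) theta = 0.
  have O : dotv theta (crossv (Omega t) theta) = 0.
    by rewrite dotv3 !mxE !I3D; ring.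
  by apply/matrixP => i j; rewrite dotv_mul_tr O !mxE mul0rn.
rewrite mulmxDl mul_scalar_mx -scalemxAl -mulmxA mulmxBr mulmxN r2O.
rewrite -scalemxAr r2 oppr0 sub0r mulmxN -scalemxAr mul_mx_scalar !scalerA.
move: (crossv _ _) => v; apply/matrixP => i j; rewrite !mxE.
by field; rewrite !gt_eqF.
Qed.

(** The factor 4 of the projection cancels the 1/4 of the inner products, so the coefficients in the
    tangent basis are the entries of [vmf_prediction]. The right-hand side is the derivative of the
    square-root density in that direction. *)
Lemma tangent_projection_vmf (t : R) theta x : theta != 0 ->
  tangent_projection (@vmf R) theta
    (sqrt_forward (Ga t) (sqrt_density (@vmf R) theta)) x =
  sqrt_density (@vmf R) theta x / 2 *
    (dotv (vmf_prediction t theta) x -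
     derive1 (@kappa R) (enorm theta) / enorm theta *
     dotv theta (vmf_prediction t theta)).
Proof.
move=> th0; rewrite /tangent_projection.
set eta := vmf_prediction t theta.
set k := derive1 (@kappa R) (enorm theta) / enorm theta.
set s := sqrt_density _ _ x.
have etaE : eta = invmx (fisher (@vmf R) theta) *m
    (- k *: (crossv (Omega t) theta + gamma ^+ 2 *: theta)).
  by rewrite -fisher_vmf_prediction// mulKmx// fisher_vmf_unit.
transitivity (\sum_i eta i 0 * (s / 2 * (x i 0 - k * theta i 0))).
  rewrite mulr_sumr; apply: eq_bigr => i _.
  rewrite etaE mxE mulr_suml mulr_sumr; apply: eq_bigr => j _.
  rewrite inner_sqrt_forward_tangent// tangent_vmf// -/k -/s.
  by rewrite [in RHS]mxE; field.
by rewrite sum3E !dotv3; ring.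
Qed.

End prediction.

(** * Equivalence of the filter equation with the equation for the parameter *)

Theorem proposition4 (R : realType) (Omega : R -> 'cV[R]_3) (gamma : R)
    (Ga : R -> ('cV[R]_3 -> R) -> 'cV[R]_3 -> R)
    (adjGa : forall t, formal_adjoint (generator Omega gamma t) (Ga t))
    (thetaF : R -> 'cV[R]_3) (t : R) (theta_neq0 : thetaF t != 0) :
  projection_filter_at (@vmf R) Ga thetaF t <->
  is_derive t 1 thetaF
    (- crossv (Omega t) (thetaF t) -
       (gamma ^+ 2 * derive1 (@kappa R) (enorm (thetaF t)) /
        (enorm (thetaF t) * derive1 (derive1 (@kappa R)) (enorm (thetaF t))))
         *: thetaF t).
Proof.
rewrite -/(vmf_prediction Omega gamma t (thetaF t)).
set eta := vmf_prediction _ _ _ _.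
pose k := derive1 (@kappa R) (enorm (thetaF t)) / enorm (thetaF t).
split=> [pf|dtheta x _]; last first.
  by rewrite (tangent_projection_vmf adjGa)//; exact: is_derive_sqrt_density.
(* Differentiability of [thetaF] is part of the conclusion, so the chain rule is applied to the
   logarithm of the given square-root density, not to [thetaF]. *)
have dlog x : sphere x -> is_derive t (1 : R) (fun s => log_vmf (thetaF s) x)
    (dotv eta x - k * dotv (thetaF t) eta).
  move=> /pf; rewrite (tangent_projection_vmf adjGa)// -/eta -/k => ds.
  have s0 := sqrt_density_gt0 (thetaF t) x.
  rewrite (_ : (fun s => _) =
      (fun s => 2 * ln (sqrt_density (@vmf R) (thetaF s) x))); last first.
    by apply/funext => s; rewrite sqrt_density_vmf expRK; field.
  have dln := @is_derive1_comp R (@ln R)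
    (fun s => sqrt_density (@vmf R) (thetaF s) x) t _ _ (is_derive1_ln s0) ds.
  apply: (is_derive_eq (is_deriveZ 2 dln)); rewrite /GRing.scale/=.
  by field; rewrite gt_eqF.
apply/is_derive_colP => i; pose e : 'cV[R]_3 := delta_mx i 0.
have Se : sphere e by apply/sphereP; rewrite dotv_delta mxE !eqxx.
have dotvN (u : 'cV[R]_3) : dotv u (- e) = - dotv u e.
  by rewrite !dotv3 !mxE; ring.
have SNe : sphere (- e).
  by move/sphereP: Se => ee; apply/sphereP; rewrite dotvN dotvC dotvN opprK.
(* In the difference of the values at [e] and [- e] the normalising term [kappa] cancels, and a
   coordinate of [thetaF] remains. *)
rewrite (_ : (fun s => _) =
    (fun s => 2^-1 * (log_vmf (thetaF s) e - log_vmf (thetaF s) (- e)))); last first.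
  by apply/funext => s; rewrite /log_vmf dotvN dotv_delta; field.
have dl := dlog _ Se; have dr := dlog _ SNe.
apply: (is_derive_eq (is_deriveZ 2^-1 (is_deriveB dl dr))).
by rewrite dotvN dotv_delta /GRing.scale/=; field.
Qed.
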